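(* Let $\mathcal{M}$ be the stable-like process associated with $\beta$ (see context). Almost surely, for every measurable set $E\subset[0,1]$, one has $$\dim_{\mathcal H}\mathcal{M}(E)\in\dim_{\mathcal H}(E)\cdot\Big[\inf_{t\in E}\beta(\mathcal{M}(t)),\ \sup_{t\in E}\beta(\mathcal{M}(t-))\Big].$$ Moreover, if the set $E$ satisfies $\dim_{\mathcal H}(E)=\dim_{\mathcal H}(E\cap\mathcal{O})$ for every non-trivial subinterval $\mathcal{O}\subset[0,1]$, then $$\dim_{\mathcal H}\mathcal{M}(E)=\dim_{\mathcal H}(E)\cdot\sup_{t\in E}\beta(\mathcal{M}(t-)).$$
   Context: Fix $\varepsilon_0>0$ and let $\beta:\mathbb{R}\to[\varepsilon_0,1-\varepsilon_0]$ be a nowhere constant (not constant on any nontrivial interval), non-decreasing, Lipschitz continuous map. Let $N(dt,dz)$ be a Poisson random measure on $[0,\infty)\times(0,\infty)$ with intensity $dt\otimes dz/z^2$ and let $(\mathcal F_t)$ be its natural filtration. The stable-like process $\mathcal{M}$ associated with $\beta$ is the unique càdlàg $(\mathcal F_t)$-adapted solution of $\mathcal{M}_t=\int_0^t\int_0^1 z^{1/\beta(\mathcal{M}_{u-})}\,N(du,dz)$, $t\in[0,1]$; it is an increasing, pure jump, strong Markov process with generator $f\mapsto \int_0^1 (f(x+u)-f(x))\beta(x)u^{-1-\beta(x)}\,du$. We write $\mathcal{M}(t)=\mathcal{M}_t$, $\mathcal{M}(t-)$ for the left limit at $t$ (with $\mathcal M(0-)=\mathcal M(0)=0$), and $\mathcal{M}(E)=\{\mathcal{M}_t:t\in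 E\}$. $\dim_{\mathcal H}$ is the Hausdorff dimension. For a number $d$ and an interval $[a,b]$, $d\cdot[a,b]=[da,db]$. *)

(* Defs.v *)
(* MathComp-Analysis *)
From HB Require Import structures.
From mathcomp Require Import all_boot all_order all_algebra.
From mathcomp Require Import all_classical all_reals all_analysis measurable_realfun.

Set Implicit Arguments.
Unset Strict Implicit.
Unset Printing Implicit Defensive.
Import Order.TTheory GRing.Theory Num.Theory.
Import numFieldNormedType.Exports.
Local Open Scope classical_set_scope.
Local Open Scope ring_scope.

(** * Hausdorff dimension of subsets of the real line *)

Definition diam (R : realType) (U : set R) : \bar R :=
  ereal_sup [set (`|x - y|)%:E | x in U & y in U].

(* The empty set is treated apart because [diam set0] is [-oo], whose zeroth
   power is 1; a nonempty set has weight 1 when [s = 0]. *)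
Definition diam_pow (R : realType) (s : R) (U : set R) : \bar R :=
  if U == set0 then 0%E else poweR (diam U) s.

Definition delta_cover (R : realType) (delta : R) (A : set R)
    (C : nat -> set R) : Prop :=
  A `<=` \bigcup_n C n /\ (forall n, (diam (C n) <= delta%:E)%E).

Definition hausdorff_content (R : realType) (s delta : R) (A : set R) :
    \bar R :=
  ereal_inf [set (\sum_(0 <= n <oo) diam_pow s (C n))%E
            | C in delta_cover delta A].

Definition hausdorff_measure (R : realType) (s : R) (A : set R) : \bar R :=
  ereal_sup [set hausdorff_content s delta A
            | delta in [set delta : R | 0 < delta]].

Definition hausdorff_dim (R : realType) (A : set R) : \bar R :=
  ereal_inf [set s%:E | s in [set s : R | 0 <= s /\
                                          hausdorff_measure s A = 0%E]].

(** * Poisson random measures *)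

(* The library's [poisson_pmf] is not used: at rate 0 it is constantly 1. *)
Definition poisson_weight (R : realType) (lambda : R) (k : nat) : R :=
  expR (- lambda) * lambda ^+ k / k`!%:R.

(* A random measure is a kernel [N]: [N w] is a measure for each outcome [w],
   and [w |-> N w B] is measurable for each measurable [B]. *)
Record poisson_random_measure (R : realType) (d d' : measure_display)
    (T : measurableType d) (P : probability T R) (Y : measurableType d')
    (nu : set Y -> \bar R) (N : R.-ker T ~> Y) : Prop := {
  prm_poisson : forall B : set Y, measurable B -> (nu B < +oo)%E ->
    forall k : nat, P [set w | N w B = k%:R%:E] =
                    (poisson_weight (fine (nu B)) k)%:E;
  prm_infinite : forall B : set Y, measurable B -> nu B = +oo%E ->
    {ae P, forall w, N w B = +oo%E};
  prm_independent : forall (n : nat) (B : 'I_n -> set Y),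
    (forall i, measurable (B i)) -> trivIset setT B ->
    forall C : 'I_n -> set (\bar R), (forall i, measurable (C i)) ->
    P [set w | forall i, C i (N w (B i))] =
    (\prod_(i < n) P [set w | C i (N w (B i))])%E }.

(* The measure dt (x) dz / z^2 on [0, oo) x (0, oo), extended by 0 to R x R. *)
Definition jump_intensity (R : realType) (B : set (R * R)) : \bar R :=
  (\int[lebesgue_measure \x lebesgue_measure]_(p in
      (B `&` (`[0, +oo[ `*` `]0, +oo[))%R) ((p.2 ^+ 2)^-1)%:E)%E.

Definition natural_filtration (R : realType) (d : measure_display)
    (T : measurableType d) (N : R.-ker T ~> (R * R)%type) (t : R) :
    set (set T) :=
  <<s [set X | exists (B : set (R * R)) (C : set (\bar R)),
         [/\ measurable B, B `<=` `[0, t] `*` `]0, +oo[, measurable C &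
             X = [set w | C (N w B)] ] ] >>.

(** * Stable-like processes *)

Definition nowhere_constant (R : realType) (f : R -> R) : Prop :=
  forall a b : R, a < b -> ~ exists c, forall x : R, a <= x <= b -> f x = c.

(* f(t-), with the convention f(0-) = f(0). *)
Definition left_limit (R : realType) (f : R -> R) (t : R) : R :=
  if t == 0 then f 0 else lim (f x @[x --> t^'-]).

Definition cadlag01 (R : realType) (f : R -> R) : Prop :=
  (forall t : R, 0 <= t < 1 -> f x @[x --> t^'+] --> f t) /\
  (forall t : R, 0 < t <= 1 -> cvg (f x @[x --> t^'-])).

(* Only the times [t] in [0, 1] are relevant. *)
Record stable_like_process (R : realType) (d : measure_display)
    (T : measurableType d) (P : probability T R)
    (N : R.-ker T ~> (R * R)%type) (beta : R -> R) (M : R -> T -> R) :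
    Prop := {
  slp_adapted : forall t : R, 0 <= t <= 1 -> forall C : set R, measurable C ->
    natural_filtration N t (M t @^-1` C);
  slp_cadlag : {ae P, forall w, cadlag01 (M^~ w)};
  slp_sde : {ae P, forall w, forall t : R, 0 <= t <= 1 ->
    (M t w)%:E =
    (\int[N w]_(p in (`]0, t] `*` `]0, 1])%R)
       (p.2 `^ (beta (left_limit (M^~ w) p.1))^-1)%:E)%E} }.

(* Main.v *)
Require Import Defs.
From HB Require Import structures.
From mathcomp Require Import all_boot all_order all_algebra.
From mathcomp Require Import all_classical all_reals all_analysis measurable_realfun.
From mathcomp Require Import ring lra zify.
Set Implicit Arguments.
Unset Strict Implicit.
Unset Printing Implicit Defensive.
Import Order.TTheory GRing.Theory Num.Theory.
Import numFieldNormedType.Exports.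
Local Open Scope classical_set_scope.
Local Open Scope ring_scope.

(** The argument is pathwise, from two almost sure properties of the Poisson
    random measure N obtained from Poisson tails and the Borel-Cantelli lemma.
    For all large n and every dyadic interval J of length about 2^-n,
    - N has a point in J x ]c, 2c] with c = 2^-n / (16(n + 1));
    - N has at most polynomially many points in J x ]2^-n, 1], and at most
      about 2^(m-n) + n + m points in J x ]2^-(m+1), 2^-m] for each m.
    A point (u, z) makes the path M jump by z^(1/beta(M(u-))), and M is
    nondecreasing. If b <= beta(M) on E, the first property makes the inverse
    of M Hoelder of every exponent below b on M(E), whence
    b dim E <= dim M(E). If beta(M(t-)) <= b < 1 on E, the second one covers
    M(E n J) by polynomially many sets of diameter at most poly(n) 2^(-n/b):
    one for each number of marks above 2^-n seen so far. Hence
    dim M(E) <= b dim E. For homogeneous E the lower bound is applied on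
    [s, t[ with s increasing to t, where beta(M(s)) tends to beta(M(t-)). *)

(** * Hausdorff measures and covers *)

Section hausdorff_dimension.
Context {R : realType}.
Implicit Types (A B U : set R) (s r : R).

Lemma diam_le U r : (forall x y, U x -> U y -> `|x - y| <= r) ->
  (diam U <= r%:E)%E.
Proof.
move=> Ur; apply: ge_ereal_sup => _ [x Ux [y Uy <-]].
by rewrite lee_fin; exact: Ur.
Qed.

Lemma le_diam U x y : U x -> U y -> (`|x - y|%:E <= diam U)%E.
Proof. by move=> Ux Uy; apply: ereal_sup_ubound; exists x => //; exists y. Qed.

Lemma diam_ge0 U : U !=set0 -> (0 <= diam U)%E.
Proof. by case=> x Ux; have := le_diam Ux Ux; rewrite subrr normr0. Qed.

Lemma diam_pow0 s : diam_pow s (@set0 R) = 0%E.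
Proof. by rewrite /diam_pow eqxx. Qed.

Lemma diam0 : diam (@set0 R) = -oo%E.
Proof.
rewrite /diam (_ : [set _ | _ in _ & _ in _] = set0) ?ereal_sup0//.
by apply/seteqP; split => // x [].
Qed.

Lemma diam_pow_ge0 s U : (0 <= diam_pow s U)%E.
Proof. by rewrite /diam_pow; case: ifP => // _; exact: poweR_ge0. Qed.

Lemma diam_pow_le s U r : 0 <= s -> (diam U <= r%:E)%E ->
  (diam_pow s U <= (r `^ s)%:E)%E.
Proof.
move=> s0 Ur; rewrite /diam_pow; case: ifPn => [_|/set0P U0].
  by rewrite lee_fin powR_ge0.
have d0 := diam_ge0 U0; rewrite -poweR_EFin.
apply: gt0_ler_poweR => //; rewrite in_itv/= leey andbT //.
exact: le_trans Ur.
Qed.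

(** Contents are nonnegative, so their supremum vanishes exactly when each of them does. *)
Lemma hausdorff_measure0P s A : hausdorff_measure s A = 0%E <->
  forall delta e : R, 0 < delta -> 0 < e ->
    exists2 C : nat -> set R, delta_cover delta A C &
      (\sum_(0 <= n <oo) diam_pow s (C n) <= e%:E)%E.
Proof.
have content_ge0 delta : (0 <= hausdorff_content s delta A)%E.
  apply: le_ereal_inf_tmp => _ [C _ <-].
  by apply: nneseries_ge0 => n _ _; exact: diam_pow_ge0.
split=> [H0 delta e delta0 e0|H].
  have : (hausdorff_content s delta A < e%:E)%E.
    apply: (@le_lt_trans _ _ 0%E); last by rewrite lte_fin.
    by rewrite -H0; apply: ereal_sup_ubound; exists delta.
  by move=> /ereal_inf_lt[_ [C AC <-] /ltW Ce]; exists C.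
apply/eqP; rewrite eq_le; apply/andP; split; last first.
  apply: (@le_trans _ _ (hausdorff_content s 1 A)) => //.
  by apply: ereal_sup_ubound; exists 1 => //=; exact: ltr01.
apply: ge_ereal_sup => _ [delta /= delta0 <-].
apply/lee_addgt0Pr => e e0; rewrite add0e.
have [C AC Ce] := H _ _ delta0 e0.
by apply: le_trans Ce; apply: ereal_inf_lbound; exists C.
Qed.

(* A double sequence of sets is flattened along a bijection between [nat] and
   [nat * nat]. *)
Lemma countable_cover_flatten s (V : nat -> nat -> set R) :
  exists W : nat -> set R,
    [/\ \bigcup_n \bigcup_j V n j `<=` \bigcup_k W k,
        forall k, exists n j, W k = V n j &
        (\sum_(0 <= k <oo) diam_pow s (W k) =
         \sum_(0 <= n <oo) \sum_(0 <= j <oo) diam_pow s (V n j))%E].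
Proof.
have /card_esym/ppcard_eqP[f] := card_nat2.
exists (fun k => V (f k).1 (f k).2); split.
- move=> x [n _ [j _ Vx]]; exists (f^-1%FUN (n, j)) => //=.
  by rewrite invK ?inE.
- by move=> k; exists (f k).1, (f k).2.
rewrite nneseries_esumT; last by move=> *; exact: diam_pow_ge0.
rewrite nneseries_esumT; last first.
  by move=> n; apply: nneseries_ge0 => *; exact: diam_pow_ge0.
rewrite [RHS](eq_esum (b := fun n => \esum_(j in setT) diam_pow s (V n j))%E);
  last first.
  by move=> n _; apply: nneseries_esumT => *; exact: diam_pow_ge0.
rewrite esum_esum; last by move=> *; exact: diam_pow_ge0.
rewrite (_ : [set: nat] `*`` (fun=> [set: nat]) = [set: nat * nat]); last first.
  by apply/seteqP; split.
by rewrite (@reindex_esum _ _ _ [set: nat] _ f)//; exact: bij.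
Qed.

(** Common scheme of both dimension bounds. [Phi U] is the part of [B] that [U] accounts for; if it
    can be covered at cost at most [K] times the weight of [U], a cover of [A] of weight [e / K]
    yields one of [B] of weight [e]. *)
Lemma hausdorff_measure_transfer A B s s' (Phi : set R -> set R) :
  (forall C : nat -> set R, A `<=` \bigcup_n C n ->
    B `<=` \bigcup_n Phi (C n)) ->
  (forall delta, 0 < delta -> exists delta0 K : R, [/\ 0 < delta0, 0 < K &
    forall U, (diam U <= delta0%:E)%E -> exists V : nat -> set R,
      [/\ Phi U `<=` \bigcup_j V j, forall j, (diam (V j) <= delta%:E)%E &
          (\sum_(0 <= j <oo) diam_pow s' (V j) <= K%:E * diam_pow s U)%E]]) ->
  hausdorff_measure s A = 0%E -> hausdorff_measure s' B = 0%E.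
Proof.
move=> PhiAB HPhi /hausdorff_measure0P H; apply/hausdorff_measure0P.
move=> delta e delta0 e0.
have [delta1 [K [delta10 K0 HU]]] := HPhi _ delta0.
have [C [AC Cdelta] Ce] := H _ _ delta10 (divr_gt0 e0 K0).
have [V HV] := choice (fun n => HU (C n) (Cdelta n)).
have [W [VW WV Wsum]] := countable_cover_flatten s' V.
exists W; first split.
- apply: subset_trans VW; apply: (subset_trans (PhiAB _ AC)).
  by apply: subset_bigcup => n _; have [] := HV n.
- by move=> k; have [n [j ->]] := WV k; have [_ + _] := HV n; exact.
- rewrite Wsum.
  apply: (@le_trans _ _ (\sum_(0 <= n <oo) K%:E * diam_pow s (C n))%E).
    apply: lee_nneseries => n *; last by have [_ _] := HV n.
    by apply: nneseries_ge0 => *; exact: diam_pow_ge0.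
  rewrite nneseriesZl; last by move=> *; exact: diam_pow_ge0.
  apply: (@le_trans _ _ (K%:E * (e / K)%:E)%E).
    by rewrite lee_wpmul2l// lee_fin ltW.
  by rewrite -EFinM mulrC divfK ?gt_eqF.
Qed.

Lemma hausdorff_dim_ge0 A : (0 <= hausdorff_dim A)%E.
Proof. by apply: le_ereal_inf_tmp => _ [s /= [s0 _] <-]; rewrite lee_fin. Qed.

Lemma hausdorff_dim_le A s : 0 <= s -> hausdorff_measure s A = 0%E ->
  (hausdorff_dim A <= s%:E)%E.
Proof. by move=> s0 As; apply: ereal_inf_lbound; exists s. Qed.

Lemma hausdorff_measure_subset s A B : A `<=` B ->
  hausdorff_measure s B = 0%E -> hausdorff_measure s A = 0%E.
Proof.
move=> AB /hausdorff_measure0P H; apply/hausdorff_measure0P => delta e d0 e0.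
have [C [BC Cd] Ce] := H _ _ d0 e0; exists C => //; split => //.
exact: subset_trans BC.
Qed.

Lemma hausdorff_dim_subset A B : A `<=` B ->
  (hausdorff_dim A <= hausdorff_dim B)%E.
Proof.
move=> AB; apply: le_ereal_inf_tmp => _ [s /= [s0 Bs] <-].
by apply: hausdorff_dim_le => //; exact: hausdorff_measure_subset Bs.
Qed.

(** The room between [s] and [s'] absorbs small losses in the exponents; it disappears in the
    infimum. *)
Lemma hausdorff_dim_scale A B (c : R) : 0 < c ->
  (forall s s', 0 <= s -> s < s' -> hausdorff_measure s A = 0%E ->
     hausdorff_measure (c * s') B = 0%E) ->
  (hausdorff_dim B <= hausdorff_dim A * c%:E)%E.
Proof.
move=> c0 H; rewrite -lee_pdivrMr//.
apply: le_ereal_inf_tmp => _ [s /= [s0 As] <-].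
apply/lee_addgt0Pr => e e0; rewrite lee_pdivrMr// -EFinD -EFinM.
rewrite mulrC; apply: hausdorff_dim_le.
  by rewrite mulr_ge0 ?(ltW c0)// addr_ge0 ?(ltW e0).
by apply: (H s) => //; rewrite ltrDl.
Qed.

End hausdorff_dimension.

(** * Intensity of boxes and the tail of the exponential series *)

Section poisson_estimates.
Context {R : realType}.

(** Half-open, so that adjacent boxes tile without overlap and [box 0 t 0 1] is the domain of
    integration in the equation of the process. *)
Definition box (a b c d : R) : set (R * R) := `]a, b] `*` `]c, d].

Lemma measurable_box (a b c d : R) : measurable (box a b c d).
Proof. by apply: measurableX; exact: measurable_itv. Qed.

Lemma boxP (a b c d : R) (p : R * R) :
  box a b c d p <-> a < p.1 <= b /\ c < p.2 <= d.
Proof. by rewrite /box /= !in_itv/=. Qed.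

Lemma lebesgue_box (a b c d : R) : a <= b -> c <= d ->
  ((@lebesgue_measure R) \x (@lebesgue_measure R))%E (box a b c d) =
  ((b - a) * (d - c))%:E.
Proof.
move=> ab cd.
have leb (u v : R) : u <= v -> @lebesgue_measure R `]u, v] = (v - u)%:E.
  move=> uv; rewrite lebesgue_measure_itv/= lte_fin.
  by case: ltgtP uv => //= ->; rewrite subrr.
transitivity (@lebesgue_measure R `]a, b] * @lebesgue_measure R `]c, d])%E.
  by apply: product_measure1E; exact: measurable_itv.
by rewrite !leb// EFinM.
Qed.

(** On the box the density [1 / z^2] lies between its values at [z = d] and [z = c]. *)
Lemma jump_intensity_box (a b c d : R) : 0 <= a -> a <= b -> 0 < c -> c <= d ->
  (((b - a) * (d - c) / d ^+ 2)%:E <= jump_intensity (box a b c d)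
     <= ((b - a) * (d - c) / c ^+ 2)%:E)%E.
Proof.
move=> a0 ab c0 cd; rewrite /jump_intensity.
have -> : box a b c d `&` `[0, +oo[ `*` `]0, +oo[ = box a b c d.
  apply/seteqP; split => [p [] //|p /[dup] + /boxP [/andP[ap _] /andP[cp _]]].
  split => //; split; rewrite /= in_itv/= andbT.
    by rewrite (le_trans a0)// ltW.
  by rewrite (lt_trans c0).
have mB := measurable_box a b c d.
have mf : measurable_fun (box a b c d) (fun p : R * R => ((p.2 ^+ 2)^-1)%:E).
  apply/measurable_EFinP.
  apply: (eq_measurable_fun (fun p : R * R => (p.2 ^+ 2) `^ (-1))).
    by move=> p _; rewrite powR_inv1// sqr_ge0.
  apply: measurable_funTS; apply: (measurableT_comp (measurable_powR _)).
  by apply: measurable_funX; exact: measurable_snd.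
have le2 (x y : R) : 0 < x -> x <= y -> (y ^+ 2)^-1 <= (x ^+ 2)^-1.
  move=> x0 xy; have y0 := lt_le_trans x0 xy.
  by rewrite lef_pV2 ?posrE ?exprn_gt0// ler_sqr ?nnegrE// ltW.
have cst_int r : (\int[lebesgue_measure \x lebesgue_measure]_(p in box a b c d)
    r%:E = ((b - a) * (d - c) * r)%:E)%E.
  rewrite integral_cst// mulrC EFinM; congr (_ * _)%E.
  exact: lebesgue_box.
rewrite -(cst_int (d ^+ 2)^-1) -(cst_int (c ^+ 2)^-1); apply/andP; split.
  apply: ge0_le_integral => // [p _|p /boxP [_ /andP[cp pd]]].
    by rewrite lee_fin invr_ge0 sqr_ge0.
  by rewrite lee_fin le2// (lt_trans c0).
apply: ge0_le_integral => // [p _|p /boxP [_ /andP[cp pd]]].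
  by rewrite lee_fin invr_ge0 sqr_ge0.
by rewrite lee_fin le2// ltW.
Qed.

(** For [j >= K] one has [x^j <= 2^-K (2 x)^j], and the tail at [2 x] is at most the whole
    series. *)
Lemma expR_tail_le (x : R) (K : nat) : 0 <= x ->
  expR x - \sum_(j < K) x ^+ j / j`!%:R <= 2^-1 ^+ K * expR (2 * x).
Proof.
move=> x0; rewrite lerBlDr; apply: limr_le; first exact: is_cvg_series_exp_coeff.
near=> n; have Kn : (K <= n)%N by near: n; exact: nbhs_infty_ge.
rewrite seriesEnat/= (big_cat_nat (leq0n K) Kn)//= big_mkord addrC lerD2r.
have y0 : 0 <= 2 * x by rewrite mulr_ge0.
apply: (@le_trans _ _ (2^-1 ^+ K * \sum_(K <= j < n) exp_coeff (2 * x) j)).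
  rewrite mulr_sumr; apply: ler_sum_nat => j /andP[Kj _].
  rewrite /exp_coeff/= mulrA ler_wpM2r// exprMn mulrA ler_peMl ?exprn_ge0//.
  by rewrite -(subnK Kj) exprD mulrCA -exprMn mulVf// expr1n mulr1 exprn_ege1// ler1n.
rewrite ler_wpM2l ?exprn_ge0//.
have cvge := @is_cvg_series_exp_coeff R (2 * x).
apply: (@le_trans _ _ (series (exp_coeff (2 * x)) n)).
  rewrite seriesEnat/= (big_cat_nat (leq0n K) Kn)//= lerDr sumr_ge0// => j _.
  exact: exp_coeff_ge0.
apply: nondecreasing_cvgn_le => //; apply: nondecreasing_series => j _ _.
exact: exp_coeff_ge0.
Unshelve. all: by end_near. Qed.

End poisson_estimates.

(** * Poisson random measures *)

Section poisson_random_measure_theory.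
Context {R : realType} {d d' : measure_display} {T : measurableType d}
  {P : probability T R} {Y : measurableType d'} {nu : set Y -> \bar R}
  {N : R.-ker T ~> Y}.
Hypothesis hN : poisson_random_measure P nu N.
Implicit Types B : set Y.

(** The complement also contains the outcomes with an infinite or non-integral count, so a bound on
    it controls these too. *)
Definition count_lt B (K : nat) : set T :=
  \bigcup_(j < K) [set w | N w B = j%:R%:E].

Lemma measurable_count B (x : \bar R) : measurable B ->
  measurable [set w | N w B = x].
Proof.
move=> mB; rewrite -[X in measurable X]setTI.
by have := @measurable_kernel _ _ _ _ _ N B mB measurableT _ (emeasurable_set1 x).
Qed.

Lemma measurable_count_lt B K : measurable B -> measurable (count_lt B K).
Proof.
by move=> mB; apply: bigcup_measurable => j _; exact: measurable_count.
Qed.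

Lemma trivIset_count B : trivIset setT (fun j => [set w | N w B = j%:R%:E]).
Proof.
apply/trivIsetP => i j _ _ ij; apply/seteqP; split => // w [/= -> [/eqP]].
by rewrite eqr_nat (negbTE ij).
Qed.

(** With [l] the mean, the tail is [exp (-l)] times a remainder of the series of [exp l], hence at
    most [exp (-l) 2^-K exp (2 l) = 2^-K exp l]. *)
Lemma poisson_tail B (lam : R) (K : nat) : measurable B ->
  (0 <= nu B <= lam%:E)%E ->
  (P (~` count_lt B K) <= (2^-1 ^+ K * expR lam)%:E)%E.
Proof.
move=> mB /andP[nu0 nulam].
have nufin : (nu B < +oo)%E by rewrite (le_lt_trans nulam)// ltry.
have /fineK nuE : nu B \is a fin_num by rewrite ge0_fin_numE.
set l := fine (nu B) in nuE.
have l0 : 0 <= l by rewrite -lee_fin nuE.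
rewrite probability_setC; last exact: measurable_count_lt.
have -> : P (count_lt B K) = (\sum_(j < K) poisson_weight l j)%:E.
  rewrite /count_lt bigcup_mkord -sumEFin.
  under [RHS]eq_bigr do rewrite -(prm_poisson hN mB nufin).
  have mF j : measurable [set w | N w B = j%:R%:E] by exact: measurable_count.
  exact: (measure_bigsetU P mF (@trivIset_count B)).
rewrite -EFinB lee_fin.
have -> : 1 - \sum_(i < K) poisson_weight l i =
    expR (- l) * (expR l - \sum_(j < K) l ^+ j / j`!%:R).
  rewrite mulrBr -expRD addNr expR0 mulr_sumr; congr (_ - _).
  by apply: eq_bigr => i _; rewrite /poisson_weight mulrA.
apply: (@le_trans _ _ (expR (- l) * (2^-1 ^+ K * expR (2 * l)))).
  by rewrite ler_wpM2l ?expR_ge0// expR_tail_le.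
rewrite mulrCA -expRD ler_wpM2l ?exprn_ge0// ler_expR.
by rewrite mulr_natl mulr2n addrA addNr add0r -lee_fin nuE.
Qed.

(** Non-integral counts lie in the complement of every [count_lt B K], and the tail bound tends to 0
    as [K] grows. *)
Lemma count_is_nat_ae B : measurable B -> (0 <= nu B < +oo)%E ->
  {ae P, forall w, exists j : nat, N w B = j%:R%:E}.
Proof.
move=> mB /andP[nu0 nufin].
have nuE : nu B = (fine (nu B))%:E by rewrite fineK// ge0_fin_numE.
pose S := ~` \bigcup_j [set w | N w B = j%:R%:E].
have mS : measurable S.
  by apply: measurableC; apply: bigcup_measurable => j _; exact: measurable_count.
exists S; split => //; last by move=> w /= Nw [j _ Nj]; apply: Nw; exists j.
apply/eqP; rewrite eq_le measure_ge0 andbT.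
have PS K : (P S <= (2^-1 ^+ K * expR (fine (nu B)))%:E)%E.
  apply: le_trans (poisson_tail K mB _); last by rewrite nu0 {1}nuE lexx.
  apply: le_measure; rewrite ?inE//.
    by apply: measurableC; exact: measurable_count_lt.
  by apply: subsetC => w [j _ Nj]; exists j.
rewrite -(@fineK _ (P S)) ?fin_num_measure// lee_fin.
have cvg0 : 2^-1 ^+ K * expR (fine (nu B)) @[K --> \oo] --> (0 : R).
  rewrite -(mul0r (expR (fine (nu B)))); apply: cvgMr_tmp.
  by apply: cvg_expr; rewrite ger0_norm// invf_lt1// ltr1n.
rewrite -(cvg_lim _ cvg0)//; apply: limr_ge; first by apply/cvg_ex; exists 0.
apply: nearW => K; rewrite -lee_fin fineK ?fin_num_measure//.
Qed.

End poisson_random_measure_theory.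

(** * Borel-Cantelli lemma over dyadic scales *)

Section dyadic_borel_cantelli.
Context {R : realType} {d : measure_display} {T : measurableType d}
  (P : probability T R).

Lemma geometric_half_le (c : nat) :
  (\sum_(0 <= m <oo) (2^-1 ^+ (c + m))%:E <= (2 * 2^-1 ^+ c : R)%:E)%E.
Proof.
apply: lime_le; first by apply: is_cvg_nneseries => *; rewrite lee_fin exprn_ge0.
apply: nearW => n; rewrite sumEFin lee_fin.
have -> : \sum_(0 <= m < n) 2^-1 ^+ (c + m) =
    2 * 2^-1 ^+ c - 2 * 2^-1 ^+ (c + n) :> R.
  elim: n => [|n IH]; first by rewrite big_geq// addn0 subrr.
  rewrite big_nat_recr//= IH addnS exprS; lra.
by rewrite gerBl mulr_ge0// exprn_ge0.
Qed.

(** The union over [m] costs a factor 2 and that over [k] a factor [2^n]; this leaves [2 * 2^-n],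
    summable in [n]. *)
Lemma dyadic_borel_cantelli (A : nat -> nat -> nat -> set T) :
  (forall n k m, measurable (A n k m)) ->
  (forall n k m, (k < 2 ^ n)%N ->
     (P (A n k m) <= (2^-1 ^+ (2 * n + m))%:E)%E) ->
  {ae P, forall w, exists n0, forall n k m, (n0 <= n)%N -> (k < 2 ^ n)%N ->
     ~ A n k m w}.
Proof.
move=> mA PA.
pose Bad n := \big[setU/set0]_(k < 2 ^ n) \bigcup_m A n k m.
have mBad n : measurable (Bad n).
  by apply: bigsetU_measurable => k _; exact: bigcup_measurable.
have PBad n : (P (Bad n) <= (2 * 2^-1 ^+ (0 + n))%:E)%E.
  apply: (@le_trans _ _ (\sum_(k < 2 ^ n) (2 * 2^-1 ^+ (2 * n))%:E)%E).
    have mU k : measurable (\bigcup_m A n k m) by exact: bigcup_measurable.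
    apply: (le_trans (Boole_inequality P (fun k _ => mU k))).
    apply: lee_sum => k _.
    apply: le_trans (geometric_half_le (2 * n)).
    apply: (@le_trans _ _ (\sum_(0 <= m <oo) P (A n k m))%E).
      by apply: measure_sigma_subadditive => //; exact: bigcup_measurable.
    by apply: lee_nneseries => // m *; exact: PA n k m (ltn_ord k).
  rewrite sumEFin lee_fin sumr_const card_ord -(mulr_natr (2 * _) (2 ^ n)) natrX.
  by rewrite mul2n -addnn exprD -!mulrA -exprMn mulVf// expr1n mulr1.
have : P (lim_sup_set Bad) = 0%E.
  apply: lim_sup_set_cvg0 => //.
  apply: (@le_lt_trans _ _ (\sum_(0 <= n <oo) 2%:E * (2^-1 ^+ (0 + n))%:E)%E).
    by apply: lee_nneseries => // n *; rewrite -EFinM; exact: PBad.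
  rewrite nneseriesZl; last by move=> *; rewrite lee_fin exprn_ge0.
  apply: (@le_lt_trans _ _ (2%:E * (2 * 2^-1 ^+ 0)%:E)%E).
    by rewrite lee_wpmul2l// geometric_half_le.
  by rewrite -EFinM ltry.
move=> P0; exists (lim_sup_set Bad); split => //.
  by apply: bigcap_measurable => // n _; exact: bigcup_measurable.
move=> w /= nw n _; apply: contrapT => nB; apply: nw; exists n => n' k m nn' k2 Aw.
apply: nB; exists n' => //; rewrite /Bad -(bigcup_mkord _ (fun k => \bigcup_m A n' k m)); exists k => //.
by exists m.
Qed.

End dyadic_borel_cantelli.

(** * Typical configurations of points *)

Section typical_configurations.
Context {R : realType}.

Definition dyad (n : nat) : R := 2^-1 ^+ n.

Lemma dyad_gt0 n : 0 < dyad n. Proof. exact: exprn_gt0. Qed.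

Lemma dyadS n : dyad n = 2 * dyad n.+1.
Proof. by rewrite /dyad exprS mulrA divff// mul1r. Qed.

Lemma dyad_le m n : (m <= n)%N -> dyad n <= dyad m.
Proof.
by move=> mn; apply: ler_wiXn2l => //; rewrite invf_le1// ler1n.
Qed.

Lemma dyad_le1 n : dyad n <= 1.
Proof. exact: (@dyad_le 0 n). Qed.

Lemma dyad_natr n : (2 ^ n)%:R * dyad n = 1.
Proof. by rewrite natrX /dyad -exprMn divff// expr1n. Qed.

(* The count in [typical_upper] is Poisson with mean at most
   [L = 2 ^ (m + 2 - n)] (truncated subtraction: the mean may be below 1), and
   reaches [K] with probability at most 2^-K * 4^L; with this [K] the bound is
   2^-(2n + m), summable over k < 2^n, m and n. *)
Definition count_bound (n m : nat) : nat := (2 * 2 ^ (m + 2 - n) + 2 * n + m)%N.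

(* The box in [typical_lower] has intensity at least
   2^-n / (4 * gap n) = 4(n + 1), so it is empty with probability at most
   exp (-4(n + 1)), summable over k < 2^n and n. *)
Definition gap (n : nat) : R := dyad n / (16 * n.+1%:R).

Lemma gap_gt0 n : 0 < gap n.
Proof. by rewrite divr_gt0 ?dyad_gt0// mulr_gt0. Qed.

(** The window in [typical_upper] has length [2 * dyad n] because a set of diameter [dyad n] may
    straddle a dyadic point. [typical_nat] concerns countably many boxes only; [count_nat] extends
    it to all right endpoints. *)
Record typical (mu : set (R * R) -> \bar R) : Prop := {
  typical_upper : exists n0, forall n k m, (n0 <= n)%N -> (k < 2 ^ n)%N ->
    exists2 j, (j < count_bound n m)%N &
      mu (box (k%:R * dyad n) (k.+2%:R * dyad n) (dyad m.+1) (dyad m)) =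
      j%:R%:E;
  typical_lower : exists n0, forall n k, (n0 <= n)%N -> (k < 2 ^ n)%N ->
    (1 <= mu (box (k%:R * dyad n) (k.+1%:R * dyad n) (gap n) (2 * gap n)))%E;
  typical_nat : forall n k i j l, exists v : nat,
    mu (box (k%:R * dyad n) (i%:R * dyad j) (dyad l) 1) = v%:R%:E }.

Lemma expR1_le4 : expR 1 <= 4 :> R.
Proof.
have h : 2^-1 <= expR (- 2^-1) :> R.
  by apply: le_trans (expR_ge1Dx _); lra.
have e2 : expR 2^-1 <= 2 :> R.
  by move: h; rewrite expRN lef_pV2 ?posrE ?expR_gt0.
rewrite (_ : 1 = 2^-1 + 2^-1 :> R); last by lra.
by rewrite expRD (le_trans (ler_pM _ _ e2 e2)) ?expR_ge0//; lra.
Qed.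

Context {d : measure_display} {T : measurableType d} {P : probability T R}
  {N : R.-ker T ~> (R * R)%type}.
Hypothesis hN : poisson_random_measure P (@jump_intensity R) N.

Lemma jump_intensity_box_fin (a b c e : R) : 0 <= a -> a <= b -> 0 < c ->
  c <= e -> (0 <= jump_intensity (box a b c e) < +oo)%E.
Proof.
move=> a0 ab c0 ce; have /andP[l u] := jump_intensity_box a0 ab c0 ce.
rewrite (le_lt_trans u) ?ltry// andbT (le_trans _ l)// lee_fin.
by rewrite divr_ge0 ?sqr_ge0// mulr_ge0// subr_ge0.
Qed.

Lemma count_box_ae_nat (a b c e : R) : 0 <= a -> 0 < c ->
  {ae P, forall w, exists v : nat, N w (box a b c e) = v%:R%:E}.
Proof.
move=> a0 c0.
have [ab|ba] := leP a b; last first.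
  apply: aeW => w; exists 0%N; rewrite /box set_itv_ge -?leNgt ?bnd_simp ?ltW//.
  by rewrite set0X measure0.
have [ce|ec] := leP c e; last first.
  apply: aeW => w; exists 0%N.
  rewrite /box [X in _ `*` X]set_itv_ge -?leNgt ?bnd_simp ?ltW//.
  by rewrite setX0 measure0.
apply: (count_is_nat_ae hN (measurable_box _ _ _ _)).
exact: jump_intensity_box_fin.
Qed.

Lemma typical_lower_ae :
  {ae P, forall w, exists n0, forall n k, (n0 <= n)%N -> (k < 2 ^ n)%N ->
    (1 <= N w (box (k%:R * dyad n) (k.+1%:R * dyad n) (gap n) (2 * gap n)))%E}.
Proof.
pose B n k := box (k%:R * dyad n) (k.+1%:R * dyad n) (gap n) (2 * gap n).
have mB n k : measurable (B n k) by exact: measurable_box.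
have k0 k n : 0 <= k%:R * dyad n by rewrite mulr_ge0 ?ler0n// ltW// dyad_gt0.
have kS k n : k%:R * dyad n <= k.+1%:R * dyad n.
  by rewrite ler_wpM2r ?ler_nat// ltW// dyad_gt0.
have natB : {ae P, forall w n k, exists v : nat, N w (B n k) = v%:R%:E}.
  apply/ae_foralln => n; apply/ae_foralln => k.
  by apply: count_box_ae_nat => //; exact: gap_gt0.
(* This event has no mark level, so only [m = 0] carries it. *)
pose A n k m := if m is 0%N then [set w | N w (B n k) = 0%R%:E] else set0.
have mA n k m : measurable (A n k m).
  by case: m => [|m]//=; exact: measurable_count.
have PA n k m : (k < 2 ^ n)%N -> (P (A n k m) <= (2^-1 ^+ (2 * n + m))%:E)%E.
  move=> _; case: m => [|m]/=; last by rewrite measure0 lee_fin exprn_ge0.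
  have g0 := gap_gt0 n.
  have gg : gap n <= 2 * gap n by lra.
  have /andP[_ nufin] := jump_intensity_box_fin (k0 k n) (kS k n) g0 gg.
  have /andP[nul nuu] := jump_intensity_box (k0 k n) (kS k n) g0 gg.
  have := prm_poisson hN (mB n k) nufin 0%N; rewrite mulr0n => ->.
  rewrite lee_fin /poisson_weight expr0 fact0 divr1 mulr1 addn0.
  have l4 : 4 * n.+1%:R <= fine (jump_intensity (B n k)).
    rewrite -lee_fin fineK ?ge0_fin_numE//; last first.
      by have /andP[] := jump_intensity_box_fin (k0 k n) (kS k n) g0 gg.
    apply: le_trans nul; rewrite lee_fin -mulrBl -natrB// subSnn mul1r.
    rewrite le_eqVlt; apply/orP; left; apply/eqP.
    have d0 := dyad_gt0 n; have n0 : (0 : R) < n.+1%:R by rewrite ltr0n.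
    rewrite /gap; field.
    by rewrite ?gt_eqF.
  have e1 : expR (-1) <= 2^-1 :> R.
    rewrite expRN lef_pV2 ?posrE ?expR_gt0//.
    by apply: le_trans (expR_ge1Dx _); lra.
  (* [exp (-4 (n + 1)) <= exp (-2 n) <= 2^-(2 n)], the latter by [e1]. *)
  apply: (@le_trans _ _ (expR (-1 * (2 * n)%:R))).
    rewrite ler_expR mulN1r lerN2; apply: le_trans l4.
    by rewrite natrM -(natr1 n); have := ler0n R n; lra.
  rewrite expRM_natr; apply: lerXn2r => //; rewrite nnegrE ?expR_ge0//.
have := dyadic_borel_cantelli mA PA.
apply: filterS2 natB => w natw [n0 Hn0]; exists n0 => n k nn0 kn.
have [[|v]] := natw n k; last by move=> ->; rewrite lee_fin ler1n.
by have := Hn0 n k 0%N nn0 kn.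
Qed.

Lemma typical_upper_ae :
  {ae P, forall w, exists n0, forall n k m, (n0 <= n)%N -> (k < 2 ^ n)%N ->
    exists2 j, (j < count_bound n m)%N &
      N w (box (k%:R * dyad n) (k.+2%:R * dyad n) (dyad m.+1) (dyad m)) =
      j%:R%:E}.
Proof.
pose B n k m := box (k%:R * dyad n) (k.+2%:R * dyad n) (dyad m.+1) (dyad m).
have mB n k m : measurable (B n k m) by exact: measurable_box.
pose A n k m := ~` count_lt (N := N) (B n k m) (count_bound n m).
have mA n k m : measurable (A n k m).
  by apply: measurableC; exact: measurable_count_lt.
have PA n k m : (k < 2 ^ n)%N -> (P (A n k m) <= (2^-1 ^+ (2 * n + m))%:E)%E.
  move=> _; have dn := dyad_gt0 n.
  have k0 : 0 <= k%:R * dyad n by rewrite mulr_ge0 ?ler0n// ltW.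
  have kS : k%:R * dyad n <= k.+2%:R * dyad n.
    by rewrite ler_wpM2r ?ler_nat ?ltW// -addn2 leq_addr.
  have dm := dyad_gt0 m.+1.
  have dmS : dyad m.+1 <= dyad m by rewrite dyad_le.
  have /andP[nu0 _] := jump_intensity_box_fin k0 kS dm dmS.
  have /andP[_ nuu] := jump_intensity_box k0 kS dm dmS.
  set L := (2 ^ (m + 2 - n))%N.
  (* The intensity is at most [2 * 2^-n / 2^-(m + 1) = 2^(m + 2 - n)] with a real exponent, which
     [L] dominates even when that exponent is negative. *)
  have nuL : (jump_intensity (B n k m) <= L%:R%:E)%E.
    apply: (le_trans nuu); rewrite lee_fin -mulrBl -natrB ?leqW// -addn2 addKn.
    rewrite ler_pdivrMr ?exprn_gt0// (dyadS m).
    rewrite (_ : 2 * dyad m.+1 - _ = dyad m.+1); last by ring.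
    rewrite expr2 mulrA ler_wpM2r ?(ltW dm)//.
    have E : (2 ^ (m + 2))%:R * dyad m.+1 = 2 :> R.
      by rewrite addn2 -[m.+2]addn1 expnD natrM mulrAC dyad_natr mul1r expn1.
    rewrite -{1}E mulrAC ler_wpM2r ?(ltW dm)//.
    apply: (@le_trans _ _ ((2 ^ (m + 2 - n) * 2 ^ n)%:R * dyad n)).
      rewrite ler_wpM2r ?(ltW dn)// ler_nat -expnD leq_exp2l//.
      by rewrite [leqRHS]addnC -leq_subLR.
    by rewrite natrM -mulrA dyad_natr mulr1.
  have nu0L : (0 <= jump_intensity (B n k m) <= L%:R%:E)%E by rewrite nu0 nuL.
  apply: (le_trans (poisson_tail hN (count_bound n m) (mB n k m) nu0L)).
  (* The part [2 L] of [count_bound] absorbs [exp L <= 4^L]; the part [2 n + m] gives the required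
     bound. *)
  rewrite lee_fin /count_bound -addnA exprD mulrAC ler_piMl ?exprn_ge0//.
  rewrite -/L -[L%:R]mul1r expRM_natr.
  apply: (@le_trans _ _ (2^-1 ^+ (2 * L) * 4 ^+ L)).
    rewrite ler_wpM2l ?exprn_ge0//; apply: lerXn2r; rewrite ?nnegrE ?expR_ge0//.
    exact: expR1_le4.
  rewrite exprM -exprMn (_ : 2^-1 ^+ 2 * 4 = 1); last by field.
  by rewrite expr1n.
have := dyadic_borel_cantelli mA PA.
apply: filterS => w [n0 Hn0]; exists n0 => n k m nn0 kn.
by have := Hn0 n k m nn0 kn; rewrite /A /setC/= => /contrapT[j /= jK Nj]; exists j.
Qed.

Lemma typical_ae : {ae P, forall w, typical (N w)}.
Proof.
have natN : {ae P, forall w n k i j l, exists v : nat,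
    N w (box (k%:R * dyad n) (i%:R * dyad j) (dyad l) 1) = v%:R%:E}.
  apply/ae_foralln => n; apply/ae_foralln => k; apply/ae_foralln => i.
  apply/ae_foralln => j; apply/ae_foralln => l.
  apply: count_box_ae_nat; last exact: dyad_gt0.
  by rewrite mulr_ge0 ?ler0n// ltW// dyad_gt0.
by apply: filterS3 natN typical_lower_ae typical_upper_ae => w.
Qed.

End typical_configurations.

(** * Counts of marks and sums of small jumps in a typical configuration *)

Section typical_counts.
Context {R : realType}.

Lemma box_subset (a b c e a' b' c' e' : R) :
  a' <= a -> b <= b' -> c' <= c -> e <= e' -> box a b c e `<=` box a' b' c' e'.
Proof.
move=> aa bb cc ee p /boxP[/andP[? ?] /andP[? ?]]; apply/boxP; split.
  by apply/andP; split; [exact: le_lt_trans aa _|exact: le_trans bb].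
by apply/andP; split; [exact: le_lt_trans cc _|exact: le_trans ee].
Qed.

Lemma box_splitl (a b c e x : R) : a <= x -> x <= b ->
  box a b c e = box a x c e `|` box x b c e /\
  box a x c e `&` box x b c e = set0.
Proof.
move=> ax xb; split; last first.
  by apply/seteqP; split => // p [/boxP[/andP[_ px] _] /boxP[/andP[]]]; rewrite ltNge px.
apply/seteqP; split => p.
  move=> /boxP[/andP[ap pb] pce]; have [px|xp] := leP p.1 x.
    by left; apply/boxP; rewrite ap px.
  by right; apply/boxP; rewrite xp pb.
by case; apply: box_subset.
Qed.

Lemma box_splitr (a b c e x : R) : c <= x -> x <= e ->
  box a b c e = box a b c x `|` box a b x e /\
  box a b c x `&` box a b x e = set0.
Proof.
move=> cx xe; split; last first.
  by apply/seteqP; split => // p [/boxP[_ /andP[_ px]] /boxP[_ /andP[]]]; rewrite ltNge px.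
apply/seteqP; split => p.
  move=> /boxP[pab /andP[cp pe]]; have [px|xp] := leP p.2 x.
    by left; apply/boxP; rewrite cp px.
  by right; apply/boxP; rewrite xp pe.
by case; apply: box_subset.
Qed.

Lemma box_empty (a b c e : R) : b <= a -> box a b c e = set0.
Proof.
move=> ba; apply/seteqP; split => // p /boxP[/andP[ap pb] _].
by have := lt_le_trans ap (le_trans pb ba); rewrite ltxx.
Qed.

Lemma exists_dyad_lt (e : R) : 0 < e -> exists n, dyad n < e.
Proof.
move=> e0; exists (Num.trunc e^-1).
rewrite -[X in _ < X]invrK /dyad exprVn ltf_pV2 ?posrE ?invr_gt0 ?exprn_gt0//.
rewrite (lt_le_trans (truncnS_gt _))// -natrX ler_nat.
exact: ltn_expl.
Qed.

Lemma dyad_bracket (x : R) n : 0 < x -> x <= dyad n ->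
  exists i, dyad (n + i).+1 < x <= dyad (n + i).
Proof.
move=> x0 xn.
have ex : exists i, dyad (n + i).+1 < x.
  have [m mx] := exists_dyad_lt x0; exists m; apply: le_lt_trans mx.
  by rewrite dyad_le// leqW// leq_addl.
case: (ex_minnP ex) => i xi Hmin; exists i; rewrite xi/=.
case: i xi Hmin => [|i] xi Hmin; first by rewrite addn0.
by rewrite leNgt; apply/negP; rewrite addnS => /Hmin; rewrite ltnn.
Qed.

Variable mu : {measure set (R * R) -> \bar R}.
Hypothesis mu_typical : typical mu.

Lemma mu_splitl (a b c e x : R) : a <= x -> x <= b ->
  mu (box a b c e) = (mu (box a x c e) + mu (box x b c e))%E.
Proof.
move=> ax xb; have [-> D] := box_splitl c e ax xb.
by rewrite measureU//; exact: measurable_box.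
Qed.

(* Integrality passes from dyadic right endpoints to [t]: the smallest count
   over dyadic endpoints tending to [t] from the right is attained, so there is
   no mass between [t] and the corresponding endpoint. *)
Lemma count_nat (n k l : nat) (t : R) :
  exists v : nat, mu (box (k%:R * dyad n) t (dyad l) 1) = v%:R%:E.
Proof.
set a := k%:R * dyad n.
have [ta|/ltW at_] := leP t a; first by exists 0%N; rewrite box_empty// measure0.
have t0 : 0 <= t by rewrite (le_trans _ at_)// mulr_ge0 ?ler0n// ltW// dyad_gt0.
(* The first multiple of [dyad j] strictly beyond [t]; it exceeds [t] by at most [dyad j]. *)
pose u j : R := (Num.trunc (t * (2 ^ j)%:R)).+1%:R * dyad j.
have tu j : t < u j.
  rewrite /u -[ltLHS]mulr1 -[X in _ * X](dyad_natr j) mulrA ltr_pM2r ?dyad_gt0//.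
  exact: truncnS_gt.
have ut j : u j <= t + dyad j.
  rewrite /u -natr1 mulrDl mul1r lerD2r -[leRHS]mulr1 -[X in _ <= _ * X](dyad_natr j) mulrA.
  rewrite ler_wpM2r ?(ltW (dyad_gt0 _))// truncn_le mulr_ge0//.
have Hv j := typical_nat mu_typical n k (Num.trunc (t * (2 ^ j)%:R)).+1 j l.
pose Q v := `[< exists j, mu (box a (u j) (dyad l) 1) = v%:R%:E >].
have exQ : exists v, Q v by have [v Ev] := Hv 0%N; exists v; apply/asboolP; exists 0%N.
case: (ex_minnP exQ) => v /asboolP[j0 Ej0] vmin; exists v.
have null j : mu (box (u j) (u j0) (dyad l) 1) = 0%E.
  have [uj|/ltW uj] := leP (u j0) (u j); first by rewrite box_empty// measure0.
  have [v' Ev'] := Hv j.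
  have vv' : (v <= v')%N by apply: vmin; apply/asboolP; exists j.
  have := mu_splitl (dyad l) 1 (le_trans at_ (ltW (tu j))) uj.
  have : (0 <= mu (box (u j) (u j0) (dyad l) 1))%E by [].
  rewrite Ej0 Ev'.
  case: (mu (box (u j) (u j0) (dyad l) 1)) => // x; rewrite lee_fin => x0 [vx].
  have : v%:R <= v'%:R :> R by rewrite ler_nat.
  by move=> vvR; congr EFin; lra.
rewrite -Ej0 (mu_splitl _ _ at_ (ltW (tu j0))).
rewrite [X in (_ + X)%E](_ : _ = 0%E) ?adde0//.
pose B j := box (u j) (u j0) (dyad l) 1.
have mB j : measurable (B j) by exact: measurable_box.
have sub : box t (u j0) (dyad l) 1 `<=` \bigcup_j B j.
  move=> p /boxP[/andP[tp pu] pl].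
  have /exists_dyad_lt[j dj] : 0 < p.1 - t by rewrite subr_gt0.
  exists j => //; apply/boxP; rewrite pu andbT; split => //.
  by rewrite (le_lt_trans (ut j))// -ltrBrDl.
have := measure_sigma_subadditive mu mB (measurable_box _ _ _ _) sub.
rewrite eseries0; last by move=> j _ _; exact: null.
by move=> le0; apply/eqP; rewrite eq_le le0 measure_ge0.
Qed.

(** The marks in []2^-n, 1]] form [n] dyadic slices, each with at most [3 n + 4] points since
    [2^(m + 2 - n) <= 2] for [m < n]. *)
Lemma count_total : exists n0, forall n k t, (n0 <= n)%N -> (k < 2 ^ n)%N ->
  t <= k.+2%:R * dyad n ->
  (mu (box (k%:R * dyad n) t (dyad n) 1) <= ((3 * n + 4) ^ 2)%:R%:E)%E.
Proof.
have [n0 H] := typical_upper mu_typical; exists n0 => n k t nn0 kn tk.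
pose F m := box (k%:R * dyad n) (k.+2%:R * dyad n) (dyad m.+1 : R) (dyad m).
apply: (@le_trans _ _ (\sum_(m < n) mu (F m))%E).
  apply: content_subadditive => [m _||]; [exact: measurable_box..|].
  rewrite -(bigcup_mkord _ F) => p /boxP[/andP[kp pt] /andP[pn p1]].
  have [|i /andP[ip pi]] := @dyad_bracket p.2 0 (lt_trans (dyad_gt0 _) pn).
    by rewrite /dyad expr0.
  rewrite !add0n in ip pi; exists i.
    rewrite /= ltnNge; apply/negP => ni.
    by have := lt_le_trans pn (le_trans pi (dyad_le ni)); rewrite ltxx.
  by apply/boxP; rewrite kp ip pi (le_trans pt).
apply: (@le_trans _ _ (\sum_(m < n) (3 * n + 4)%:R%:E)%E).
  apply: lee_sum => m _; have [j jK ->] := H n k m nn0 kn.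
  rewrite lee_fin ler_nat (leq_trans (ltnW jK))// /count_bound.
  have mn := ltn_ord m.
  have : (2 ^ (m + 2 - n) <= 2 ^ 1)%N by rewrite leq_exp2l//; lia.
  lia.
rewrite sumEFin lee_fin sumr_const card_ord -(mulr_natr (3 * n + 4)%:R) -natrM ler_nat.
by rewrite expnS expn1 leq_mul2l; apply/orP; right; lia.
Qed.

Lemma geometric_sum_le (c q : R) : 0 <= c -> 0 <= q -> q < 1 ->
  (\sum_(0 <= i <oo) (c * q ^+ i)%:E <= (c / (1 - q))%:E)%E.
Proof.
move=> c0 q0 q1.
apply: lime_le.
  by apply: is_cvg_nneseries => *; rewrite lee_fin mulr_ge0// exprn_ge0.
apply: nearW => n; rewrite sumEFin lee_fin -mulr_sumr ler_wpM2l//.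
have -> : \sum_(0 <= i < n) q ^+ i = (1 - q ^+ n) / (1 - q).
  elim: n => [|n IH]; first by rewrite big_geq// expr0 subrr mul0r.
  rewrite big_nat_recr//= IH exprS; field.
  by rewrite subr_eq0 eq_sym lt_eqF.
by rewrite ler_pdivrMr ?subr_gt0// mulVf ?gt_eqF ?subr_gt0// gerBl exprn_ge0.
Qed.

(** The slice at level [n + i] holds at most [9 (n + 1) 2^i] points, each contributing at most
    [2^(-(n + i) / b)]. The sum over [i] is geometric of ratio [q = 2 * 2^(-1 / b)], and [q < 1]
    because [b < 1]. *)
Lemma small_jumps_le (b : R) : 0 < b -> b < 1 ->
  exists n0 C, 0 < C /\ forall n k, (n0 <= n)%N -> (k < 2 ^ n)%N ->
  (\int[mu]_(p in box (k%:R * dyad n) (k.+2%:R * dyad n) 0 (dyad n))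
     (p.2 `^ b^-1)%:E <= (C * (n.+1%:R * dyad n `^ b^-1))%:E)%E.
Proof.
move=> b0 b1; have [n0 H] := typical_upper mu_typical.
pose q : R := 2 * 2^-1 `^ b^-1.
have q0 : 0 <= q by rewrite mulr_ge0// powR_ge0.
have q1 : q < 1.
  have l0 : ln 2^-1 < 0 :> R.
    by apply: ln_lt0; rewrite invr_gt0 ltr0n/= invf_lt1// ltr1n.
  have e2 : 2 = expR (- ln 2^-1) :> R by rewrite expRN lnK ?posrE// invrK.
  rewrite /q /powR gt_eqF// [X in X * _]e2 -expRD expR_lt1.
  have : 1 < b^-1 by rewrite invf_gt1.
  by move: l0; set l := ln _; nra.
exists n0, (9 / (1 - q)); split; first by rewrite divr_gt0// subr_gt0.
move=> n k nn0 kn.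
set a := k%:R * dyad n; set e := k.+2%:R * dyad n.
pose F i := box a e (dyad (n + i).+1 : R) (dyad (n + i)).
have mF i : measurable (F i) by exact: measurable_box.
have FE : box a e 0 (dyad n) = \bigcup_i F i.
  apply/seteqP; split => p.
    move=> /boxP[pa /andP[p0 pn]]; have [i Hi] := dyad_bracket p0 pn.
    by exists i => //; apply/boxP.
  move=> [i _]; apply: box_subset => //; first exact: ltW (dyad_gt0 _).
  by apply: dyad_le; rewrite leq_addr.
have tF : trivIset setT F.
  have disj i j : (i < j)%N -> F i `&` F j = set0.
    move=> ij; apply/seteqP; split => // p.
    move=> [/boxP[_ /andP[pi _]] /boxP[_ /andP[_ pj]]].
    have ji : dyad (n + j) <= dyad (n + i).+1 :> R by apply: dyad_le; lia.
    by have := lt_le_trans pi (le_trans pj ji); rewrite ltxx.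
  apply/trivIsetP => i j _ _; rewrite neq_ltn => /orP[|] ij; first exact: disj.
  by rewrite setIC disj.
have mg (D : set (R * R)) : measurable_fun D (fun p : R * R => (p.2 `^ b^-1)%:E).
  apply/measurable_EFinP; apply: measurable_funTS.
  by apply: (measurableT_comp (measurable_powR _)); exact: measurable_snd.
rewrite FE ge0_integral_bigcup//; last by move=> p _; rewrite lee_fin powR_ge0.
have c0 : 0 <= 9 * (n.+1%:R * dyad n `^ b^-1).
  by rewrite mulr_ge0// mulr_ge0// powR_ge0.
apply: (@le_trans _ _ (\sum_(0 <= i <oo)
    ((9 * (n.+1%:R * dyad n `^ b^-1)) * q ^+ i)%:E)%E); last first.
  by apply: (le_trans (geometric_sum_le c0 q0 q1)); rewrite lee_fin mulrAC.
apply: lee_nneseries => i *.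
  by apply: integral_ge0 => p _; rewrite lee_fin powR_ge0.
apply: (@le_trans _ _ (\int[mu]_(p in F i) cst (dyad (n + i) `^ b^-1)%:E p)%E).
  apply: ge0_le_integral => //.
    by move=> p _; rewrite lee_fin powR_ge0.
  move=> p /boxP[_ /andP[ip pi]]; rewrite lee_fin.
  have p0 : 0 <= p.2 by rewrite ltW// (lt_trans (dyad_gt0 _) ip).
  by apply: ge0_ler_powR => //; rewrite ?nnegrE ?invr_ge0 ?ltW// dyad_gt0.
rewrite integral_cst//; have [j jK ->] := H n k (n + i)%N nn0 kn.
rewrite -EFinM lee_fin.
have jb : j%:R <= 9 * n.+1%:R * 2 ^+ i :> R.
  (* [count_bound n (n + i)] equals [8 * 2^i + 3 n + i], and [i < 2^i]. *)
  have : (j <= 9 * n.+1 * 2 ^ i)%N.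
    apply: (leq_trans (ltnW jK)); rewrite /count_bound.
    rewrite (_ : n + i + 2 - n = i + 2)%N; last by lia.
    rewrite expnD; have := ltn_expl i (isT : 1 < 2)%N.
    set x := (2 ^ i)%N => ix.
    have : (n * 1 <= n * x)%N by rewrite leq_mul2l; apply/orP; right; lia.
    rewrite (_ : (2 ^ 2 = 4)%N)//; lia.
  by rewrite -(ler_nat R) !natrM natrX.
rewrite /dyad exprD -/(dyad n) powRM ?(ltW (dyad_gt0 _)) ?exprn_ge0//.
have -> : (2^-1 ^+ i) `^ b^-1 = (2^-1 `^ b^-1) ^+ i :> R.
  by rewrite -powR_mulrn// -powRrM mulrC powRrM powR_mulrn// powR_ge0.
set y := 2^-1 `^ b^-1; rewrite /q -/y exprMn.
have z0 : 0 <= dyad n `^ b^-1 * y ^+ i.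
  by rewrite mulr_ge0 ?powR_ge0// exprn_ge0// powR_ge0.
apply: (le_trans (ler_wpM2l z0 jb)).
rewrite le_eqVlt; apply/orP; left; apply/eqP; ring.
Qed.

End typical_counts.

(** * Polynomial factors against powers of dyadic scales *)

Section dyadic_asymptotics.
Context {R : realType}.

Lemma dyad_powR_gt0 n (x : R) : 0 < dyad n `^ x.
Proof. by rewrite powR_gt0// dyad_gt0. Qed.

Lemma dyad_powRD n (x y : R) : dyad n `^ (x + y) = dyad n `^ x * dyad n `^ y.
Proof. by rewrite powRD//; apply/implyP => _; rewrite gt_eqF ?dyad_gt0. Qed.

(** With [a = eps * ln 2], [2^(n eps) = exp (n a) >= 1 + n a], and
    [(1 + 1 / a) (1 + n a) >= n + 1]. *)
Lemma natS_le_dyad_powR (eps : R) : 0 < eps ->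
  exists C : R, 0 < C /\ forall n, n.+1%:R <= C * dyad n `^ (- eps).
Proof.
move=> eps0.
have l2 : 0 < ln 2 :> R by rewrite ln_gt0// ltr1n.
have el : 0 < eps * ln 2 by rewrite mulr_gt0.
exists (1 + (eps * ln 2)^-1); split; first by rewrite addr_gt0 ?invr_gt0.
move=> n.
have -> : dyad n `^ (- eps) = expR (n%:R * (eps * ln 2)).
  rewrite /powR gt_eqF ?dyad_gt0// /dyad lnXn ?invr_gt0// lnV ?posrE//.
  by congr expR; rewrite -mulr_natl; ring.
apply: (@le_trans _ _ ((1 + (eps * ln 2)^-1) * (1 + n%:R * (eps * ln 2)))).
  rewrite -natr1; move: el; set a := eps * _ => a0.
  have -> : (1 + a^-1) * (1 + n%:R * a) = n%:R + 1 + (n%:R * a + a^-1).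
    by field; rewrite gt_eqF.
  by rewrite lerDl addr_ge0 ?invr_ge0 ?mulr_ge0// ltW.
by rewrite ler_wpM2l ?expR_ge1Dx// ltW// addr_gt0 ?invr_gt0.
Qed.

Lemma exists_dyad_powR_le (x e : R) : 0 < x -> 0 < e ->
  exists n0, forall n, (n0 <= n)%N -> dyad n `^ x <= e.
Proof.
move=> x0 e0; have ex : 0 < e `^ x^-1 by rewrite powR_gt0.
have [n0 Hn0] := exists_dyad_lt ex; exists n0 => n nn0.
rewrite -[leRHS]powRr1 ?(ltW e0)// -(mulVf (lt0r_neq0 x0)) powRrM.
apply: ge0_ler_powR; rewrite ?nnegrE ?powR_ge0 ?(ltW x0) ?(ltW (dyad_gt0 _))//.
by rewrite (le_trans (dyad_le nn0))// ltW.
Qed.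

Lemma eseries_bounded_support (g : nat -> \bar R) (L : nat) (c : R) :
  (forall j, (0 <= g j <= c%:E)%E) -> (forall j, (L <= j)%N -> g j = 0%E) ->
  (\sum_(0 <= j <oo) g j <= (L%:R * c)%:E)%E.
Proof.
move=> g0 gL; rewrite (nneseries_split 0 L); last by move=> j _; case/andP: (g0 j).
rewrite add0n [X in (_ + X)%E]eseries0 ?adde0; last by move=> j Lj _; exact: gL.
apply: (@le_trans _ _ (\sum_(0 <= j < L) c%:E)%E).
  by apply: lee_sum => j _; case/andP: (g0 j).
by rewrite sumEFin lee_fin sumr_const_nat subn0 mulr_natl.
Qed.

End dyadic_asymptotics.

(** * Increments of the path *)

Section jump_path.
Context {R : realType}.
Variables (eps0 : R) (beta : R -> R) (mu : {measure set (R * R) -> \bar R})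
  (f : R -> R).
Hypothesis eps0_gt0 : 0 < eps0.
Hypothesis beta_range : forall x : R, eps0 <= beta x <= 1 - eps0.
Hypothesis beta_mono : {homo beta : x y / x <= y}.
Hypothesis f_cadlag : cadlag01 f.

Let jump (p : R * R) : R := p.2 `^ (beta (left_limit f p.1))^-1.

Hypothesis f_sde : forall t : R, 0 <= t <= 1 ->
  (f t)%:E = (\int[mu]_(p in box 0 t 0 1) (jump p)%:E)%E.

Lemma beta_gt0 x : 0 < beta x.
Proof. by have /andP[+ _] := beta_range x; exact: lt_le_trans. Qed.

(* Monotonicity comes before measurability of the integrand, which relies on
   it: simple functions below the integrand on the smaller box are below it on
   the larger one. *)
Lemma path_mono s t : 0 <= s -> s <= t -> t <= 1 -> f s <= f t.
Proof.
move=> s0 st t1; rewrite -lee_fin !f_sde ?s0 ?t1 ?(le_trans s0 st) ?(le_trans st t1)//.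
rewrite !ge0_integralE; try by move=> p _; rewrite lee_fin powR_ge0.
apply: ereal_sup_le => _ [h /= hf <-]; exists h => //= p.
apply: (le_trans (hf p)); rewrite !patchE; case: ifPn => [|_].
  rewrite inE => /boxP[/andP[p0 ps] p2].
  rewrite ifT// inE; apply/boxP; split => //.
  by rewrite p0 (le_trans ps).
by case: ifPn => // _; rewrite lee_fin powR_ge0.
Qed.

Lemma left_limit_bounds s u : 0 <= s -> s < u -> u <= 1 ->
  f s <= left_limit f u <= f u.
Proof.
move=> s0 su u1; have u0 := le_lt_trans s0 su.
rewrite /left_limit gt_eqF//.
have cf : cvg (f x @[x --> u^'-]) by apply: f_cadlag.2; rewrite u0.
apply/andP; split.
  apply: limr_ge => //; near=> x; apply: path_mono => //.
    by apply: ltW; near: x; exact: nbhs_left_gt.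
  by rewrite (le_trans _ u1)// ltW//; near: x; exact: nbhs_left_lt.
apply: limr_le => //; near=> x; apply: path_mono => //.
by apply: ltW; near: x; exact: nbhs_left_gt.
Unshelve. all: by end_near. Qed.

Lemma left_limit_mono s t : 0 <= s -> s <= t -> t <= 1 ->
  left_limit f s <= left_limit f t.
Proof.
move=> s0; rewrite le_eqVlt => /predU1P[->//|st] t1.
have /andP[fst _] := left_limit_bounds s0 st t1.
apply: le_trans fst; move: s0; rewrite le_eqVlt => /predU1P[<-|s0].
  by rewrite /left_limit eqxx.
by have /andP[] := left_limit_bounds (lexx 0) s0 (le_trans (ltW st) t1).
Qed.

(** The exponent is nonincreasing in time, hence Borel; clamping the time to [[0, 1]] makes it
    monotone on the whole line. The power is then [exp (h u * ln z)], as [z > 0]. *)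
Lemma measurable_jump : measurable_fun (box 0 1 0 1) jump.
Proof.
pose h (u : R) := (beta (left_limit f (Num.max 0 (Num.min 1 u))))^-1.
have mh : measurable_fun [set: R] h.
  apply: nonincreasing_measurable => // u v uv.
  rewrite /h lef_pV2 ?posrE ?beta_gt0//; apply: beta_mono.
  apply: left_limit_mono.
  - by rewrite le_max lexx.
  - rewrite ge_max le_max lexx/= le_max; apply/orP; right.
    by rewrite le_min !ge_min lexx uv !orbT.
  - by rewrite ge_max ler01 ge_min lexx.
apply: (eq_measurable_fun (fun p : R * R => expR (h p.1 * ln p.2))).
  move=> p; rewrite inE => /boxP[/andP[p10 p11] /andP[p20 p21]].
  have hE : h p.1 = (beta (left_limit f p.1))^-1.
    by rewrite /h min_r// max_r// ltW.
  rewrite hE /jump /powR.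
  by rewrite (gt_eqF p20).
apply: measurable_funTS; apply: (measurableT_comp (@measurable_expR R)).
apply: measurable_funM.
  by apply: (measurableT_comp mh); exact: measurable_fst.
by apply: (measurableT_comp (@measurable_ln R)); exact: measurable_snd.
Qed.

Lemma path_increment s t : 0 <= s -> s <= t -> t <= 1 ->
  (f t)%:E = ((f s)%:E + \int[mu]_(p in box s t 0 1) (jump p)%:E)%E.
Proof.
move=> s0 st t1; rewrite !f_sde ?s0 ?t1 ?(le_trans s0 st) ?(le_trans st t1)//.
have [E D] := @box_splitl _ 0 t 0 1 s s0 st.
rewrite E ge0_integral_setU//; try exact: measurable_box.
- rewrite -E; apply/measurable_EFinP; apply: measurable_funS measurable_jump.
    exact: measurable_box.
  exact: box_subset.
- by move=> p _; rewrite lee_fin powR_ge0.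
- by apply/disj_setPS; rewrite D.
Qed.

Lemma le_increment s t c : 0 <= s -> s <= t -> t <= 1 ->
  (c%:E <= \int[mu]_(p in box s t 0 1) (jump p)%:E)%E -> c <= f t - f s.
Proof.
move=> s0 st t1; have := path_increment s0 st t1.
(* An infinite integral is excluded because [f t] is real. *)
case: (\int[mu]_(p in _) _)%E => // r [->].
by rewrite lee_fin addrAC subrr add0r.
Qed.

Lemma increment_le s t c : 0 <= s -> s <= t -> t <= 1 ->
  (\int[mu]_(p in box s t 0 1) (jump p)%:E <= c%:E)%E -> f t - f s <= c.
Proof.
move=> s0 st t1; have := path_increment s0 st t1.
case: (\int[mu]_(p in _) _)%E => // r [->].
by rewrite lee_fin addrAC subrr add0r.
Qed.

(** Mass 1 in the box suffices: its marks [z] lie in []gap n, 1]], and [beta] at the left limits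
    there is at least [beta (f s) >= b], so jumps are at least [z^(1 / b)]. *)
Lemma increment_ge (n k : nat) (s t b : R) :
  (1 <= mu (box (k%:R * dyad n) (k.+1%:R * dyad n) (gap n) (2 * gap n)))%E ->
  0 <= s -> s <= k%:R * dyad n -> k.+1%:R * dyad n <= t -> t <= 1 ->
  0 < b -> b <= beta (f s) -> gap n `^ b^-1 <= f t - f s.
Proof.
move=> mu1 s0 sk kt t1 b0 bs.
have g0 := gap_gt0 (R := R) n.
have g1 : 2 * gap n <= 1 :> R.
  have : (1 : R) <= n.+1%:R by rewrite ler1n.
  have := dyad_le1 (R := R) n; rewrite /gap => d1 n1.
  rewrite mulrA ler_pdivrMr; last by rewrite mulr_gt0// ltr0n.
  lra.
have st : s <= t.
  rewrite (le_trans sk)// (le_trans _ kt)// ler_wpM2r ?ler_nat//.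
  exact/ltW/dyad_gt0.
apply: le_increment => //.
set B := box (k%:R * dyad n) _ _ _ in mu1.
have mB : measurable B by exact: measurable_box.
have BS : B `<=` box s t 0 1 by apply: box_subset => //; exact: ltW.
have B01 : B `<=` box 0 1 0 1.
  by apply: subset_trans BS _; apply: box_subset.
have mS : measurable_fun (box s t 0 1) (fun p => (jump p)%:E).
  apply/measurable_EFinP; apply: measurable_funS measurable_jump.
    exact: measurable_box.
  exact: box_subset.
apply: (@le_trans _ _ (\int[mu]_(p in B) (jump p)%:E)%E); last first.
  apply: ge0_subset_integral => //; first exact: measurable_box.
  by move=> p _; rewrite lee_fin powR_ge0.
apply: (@le_trans _ _ (\int[mu]_(p in B) cst (gap n `^ b^-1)%:E p)%E).
  rewrite integral_cst//; rewrite -[leLHS]mule1 lee_wpmul2l//.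
  by rewrite lee_fin powR_ge0.
apply: ge0_le_integral => //.
- by move=> p _; rewrite lee_fin powR_ge0.
- by apply: measurable_funS mS => //; exact: measurable_box.
move=> p Bp; have /boxP[/andP[kp pk] /andP[gp pg]] := Bp.
have /boxP[/andP[sp pt] /andP[p0 p1]] := BS _ Bp.
rewrite lee_fin /jump.
apply: (@le_trans _ _ (p.2 `^ b^-1)).
  by apply: ge0_ler_powR; rewrite ?nnegrE ?invr_ge0// ltW.
apply: ger_powR; first by rewrite p0.
rewrite lef_pV2 ?posrE ?beta_gt0//; apply: (le_trans bs); apply: beta_mono.
by have /andP[] := left_limit_bounds s0 sp (le_trans pt t1).
Qed.

(** Equal finite counts leave no mass above [dyad n] between [s] and [t]; the remaining marks
    satisfy [z <= 1], so the bound on [beta] gives jumps of at most [z^(1 / b)]. *)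
Lemma increment_le_small_jumps (n k v : nat) (s t b c : R) :
  0 < b -> k%:R * dyad n <= s -> s <= t -> t <= k.+2%:R * dyad n -> t <= 1 ->
  (forall u, s < u <= t -> beta (left_limit f u) <= b) ->
  mu (box (k%:R * dyad n) s (dyad n) 1) = v%:R%:E ->
  mu (box (k%:R * dyad n) t (dyad n) 1) = v%:R%:E ->
  (\int[mu]_(p in box (k%:R * dyad n) (k.+2%:R * dyad n) 0 (dyad n))
     (p.2 `^ b^-1)%:E <= c%:E)%E ->
  f t - f s <= c.
Proof.
move=> b0 ks st tk t1 ub mus mut ic.
have k0 : 0 <= k%:R * dyad n :> R by rewrite mulr_ge0 ?ler0n// ltW// dyad_gt0.
have s0 := le_trans k0 ks.
have mg (D : set (R * R)) : measurable_fun D (fun p : R * R => (p.2 `^ b^-1)%:E).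
  apply/measurable_EFinP; apply: measurable_funTS.
  by apply: (measurableT_comp (measurable_powR _)); exact: measurable_snd.
have g0 (D : set (R * R)) p : D p -> (0 <= (p.2 `^ b^-1)%:E)%E.
  by rewrite lee_fin powR_ge0.
have mb := measurable_box (R := R).
apply: increment_le => //.
apply: (@le_trans _ _ (\int[mu]_(p in box s t 0 1) (p.2 `^ b^-1)%:E)%E).
  apply: ge0_le_integral => //.
  - by move=> p _; rewrite lee_fin powR_ge0.
  - apply/measurable_EFinP; apply: measurable_funS measurable_jump => //.
    exact: box_subset.
  move=> p /boxP[/ub bp p2]; rewrite lee_fin; apply: ger_powR => //.
  by rewrite lef_pV2 ?posrE ?beta_gt0.
have [-> D] := box_splitr s t (ltW (dyad_gt0 n)) (dyad_le1 (R := R) n).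
rewrite ge0_integral_setU//; last by apply/disj_setPS; rewrite D.
rewrite [X in (_ + X)%E]null_set_integral ?adde0//; last first.
  have := mu_splitl mu (dyad n) 1 ks st; rewrite mus mut.
  by case: (mu (box s t _ _)) => // x [vx]; congr EFin; lra.
apply: le_trans ic; apply: ge0_subset_integral => //.
- by move=> p _; rewrite lee_fin powR_ge0.
- exact: box_subset.
- by move=> p _; rewrite lee_fin powR_ge0.
Qed.

(* The times of [X] are classified by the number of jump marks above [dyad n]
   seen so far; two times in the same class are separated by small jumps only. *)
Lemma path_cover (E : set R) (b eps : R) : typical mu ->
  0 < b -> b < 1 -> 0 < eps -> E `<=` `[0, 1] ->
  (forall t, E t -> beta (left_limit f t) <= b) ->
  exists n0 D, 0 < D /\ forall n k (X : set R), (n0 <= n)%N -> (k < 2 ^ n)%N ->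
    X `<=` E -> (forall t, X t -> k%:R * dyad n <= t <= k.+2%:R * dyad n) ->
    exists V : nat -> set R,
      [/\ f @` X `<=` \bigcup_j V j,
          forall j, (diam (V j) <= (D * dyad n `^ (b^-1 - eps))%:E)%E &
          exists L : nat, L%:R <= D * dyad n `^ (- eps) /\
            forall j, (L <= j)%N -> V j = set0].
Proof.
move=> tmu b0 b1 e0 E01 Eb.
have [n1 count_le] := count_total tmu.
have [n2 [C [C0 small_le]]] := small_jumps_le tmu b0 b1.
(* Half of [eps], because the count of large marks is quadratic in [n + 1]. *)
have [C1 [C10 HC1]] := natS_le_dyad_powR (divr_gt0 e0 (ltr0Sn R 1)).
have [C2 [C20 HC2]] := natS_le_dyad_powR e0.
(* The first summand serves the number of classes, the second their diameters. *)
exists (maxn n1 n2), (17 * C1 ^+ 2 + C * C2); split.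
  by rewrite addr_gt0// mulr_gt0// exprn_gt0.
move=> n k X; rewrite geq_max => /andP[nn1 nn2] kn XE Xk.
exists (fun j => f @` (X `&` [set t | mu (box (k%:R * dyad n) t (dyad n) 1) = j%:R%:E])).
split.
- move=> _ [t Xt <-]; have [v Ev] := count_nat tmu n k n t.
  by exists v => //; exists t.
- move=> j; apply: (@le_trans _ _ (C * (n.+1%:R * dyad n `^ b^-1))%:E); last first.
    rewrite lee_fin dyad_powRD; set y := _ `^ b^-1; set z := _ `^ (- eps).
    have y0 : 0 <= y by exact: powR_ge0.
    have z0 : 0 <= z by exact: powR_ge0.
    apply: (@le_trans _ _ (C * (C2 * z * y))).
      by rewrite ler_wpM2l ?(ltW C0)// ler_wpM2r// HC2.
    rewrite (_ : C * (C2 * z * y) = C * C2 * (y * z)); last by ring.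
    rewrite ler_wpM2r ?mulr_ge0// lerDr mulr_ge0// exprn_ge0// ltW//.
  have incr s t : X s -> X t ->
      mu (box (k%:R * dyad n) s (dyad n) 1) = j%:R%:E ->
      mu (box (k%:R * dyad n) t (dyad n) 1) = j%:R%:E -> s <= t ->
      `|f s - f t| <= C * (n.+1%:R * dyad n `^ b^-1).
    move=> Xs Xt mus mut st.
    have /Xk/andP[ks _] := Xs; have /Xk/andP[_ tk] := Xt.
    have := E01 _ (XE _ Xs); have := E01 _ (XE _ Xt).
    rewrite /= !in_itv/= => /andP[_ t1] /andP[s0 _].
    rewrite distrC ger0_norm ?subr_ge0; last exact: path_mono.
    apply: (increment_le_small_jumps b0 ks st tk t1 _ mus mut (small_le _ _ nn2 kn)).
    (* The bound is assumed at times of [E] only; monotonicity carries it from [t] to all earlier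
       [u]. *)
    move=> u /andP[su ut]; apply: le_trans (Eb _ (XE _ Xt)); apply: beta_mono.
    by apply: left_limit_mono => //; rewrite ltW// (le_lt_trans s0).
  apply: diam_le => _ _ [s [Xs mus] <-] [t [Xt mut] <-].
  by have [st|/ltW ts] := leP s t; [|rewrite distrC]; exact: incr.
(* Counts run from 0 to [(3 n + 4)^2] inclusive, and [(3 n + 4)^2 + 1 <= 17 (n + 1)^2]. *)
exists ((3 * n + 4) ^ 2).+1; split.
  apply: (@le_trans _ _ (17 * n.+1%:R ^+ 2)).
    by rewrite -natrX -natrM ler_nat -!mulnn; nia.
  set w := dyad n `^ (- (eps / 2)).
  have -> : dyad n `^ (- eps) = w ^+ 2.
    by rewrite expr2 /w -dyad_powRD; congr (_ `^ _); lra.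
  rewrite (_ : (17 * C1 ^+ 2 + C * C2) * w ^+ 2 =
    17 * (C1 * w) ^+ 2 + C * C2 * w ^+ 2); last by ring.
  rewrite ler_wpDr//; first by rewrite mulr_ge0 ?sqr_ge0// mulr_ge0// ltW.
  rewrite ler_wpM2l// lerXn2r ?nnegrE//; first by rewrite mulr_ge0 ?powR_ge0// ltW.
move=> j jL; apply/seteqP; split => // _ [t [Xt /= mut] _].
have /Xk/andP[_ tk] := Xt; have := count_le n k t nn1 kn tk.
by rewrite mut lee_fin ler_nat leqNgt jL.
Qed.

End jump_path.

(** * Distortion of dimension *)

Section dimension_distortion.
Context {R : realType}.
Implicit Types (E X U : set R) (f : R -> R).

Lemma diam_powE (s d : R) U : U !=set0 -> diam U = d%:E ->
  diam_pow s U = (d `^ s)%:E.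
Proof. by move=> /set0P/negbTE U0 Ud; rewrite /diam_pow U0 Ud. Qed.

Lemma diam_fin U (r : R) : U !=set0 -> (diam U <= r%:E)%E ->
  exists d : R, [/\ diam U = d%:E, 0 <= d & d <= r].
Proof.
move=> /diam_ge0 d0 dr; exists (fine (diam U)).
have fd : diam U \is a fin_num.
  by rewrite ge0_fin_numE// (le_lt_trans dr)// ltry.
by rewrite fineK// -!lee_fin fineK.
Qed.

Lemma dyadic_window X n : X !=set0 -> X `<=` `[0, 1] ->
  (forall x y, X x -> X y -> `|x - y| <= dyad n) ->
  exists k, (k < 2 ^ n)%N /\
    forall t, X t -> k%:R * dyad n <= t <= k.+2%:R * dyad n.
Proof.
move=> [x0 Xx0] X01 Xd.
have X0 t : X t -> 0 <= t by move=> /X01; rewrite /= in_itv/= => /andP[].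
have X1 t : X t -> t <= 1 by move=> /X01; rewrite /= in_itv/= => /andP[].
have dn := dyad_gt0 (R := R) n.
have X0set : X !=set0 by exists x0.
have infX t : X t -> inf X <= t.
  by move=> Xt; apply: inf_lbound => //; exists 0 => u /X0.
have Xinf t : X t -> t <= inf X + dyad n.
  move=> Xt; rewrite -lerBlDr; apply: lb_le_inf => // u Xu.
  by rewrite lerBlDr addrC -lerBlDr (le_trans (ler_norm _))// Xd.
have inf0 : 0 <= inf X by apply: lb_le_inf => // u /X0.
set q := Num.trunc (inf X * (2 ^ n)%:R).
have i0 : 0 <= inf X * (2 ^ n)%:R by rewrite mulr_ge0.
have unit_dyad (x : R) : x = x * (2 ^ n)%:R * dyad n.
  by rewrite -mulrA dyad_natr mulr1.
have n0 : (0 < 2 ^ n)%N by rewrite expn_gt0.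
(* The cap keeps [k] below [2^n] when [inf X = 1]. *)
exists (minn q (2 ^ n).-1); split; first by lia.
move=> t Xt; apply/andP; split.
  apply: le_trans (infX _ Xt); rewrite [leRHS]unit_dyad ler_wpM2r ?(ltW dn)//.
  rewrite (@le_trans _ _ q%:R)// ?ler_nat ?geq_minl//.
  by rewrite truncn_le.
have [qn|nq] := leqP q (2 ^ n).-1.
  rewrite (le_trans (Xinf _ Xt))//.
  rewrite -[k in k%:R * _]addn1 natrD mulrDl mul1r lerD2r.
  rewrite [leLHS]unit_dyad ler_wpM2r ?(ltW dn)// ltW//.
  exact: truncnS_gt.
rewrite (le_trans (X1 _ Xt))// -[leLHS](dyad_natr n).
by rewrite ler_wpM2r ?(ltW dn)// ler_nat; lia.
Qed.

(** The first dyadic point after [s] is within [dyad n], which leaves a full interval before [t]. *)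
Lemma dyadic_inside (s t : R) n : 0 <= s -> t <= 1 -> 2 * dyad n <= t - s ->
  exists k, [/\ (k < 2 ^ n)%N, s <= k%:R * dyad n & k.+1%:R * dyad n <= t].
Proof.
move=> s0 t1 ts; have dn := dyad_gt0 (R := R) n.
have unit_dyad (x : R) : x = x * (2 ^ n)%:R * dyad n.
  by rewrite -mulrA dyad_natr mulr1.
set q := Num.trunc (s * (2 ^ n)%:R).
have q1 : q%:R * dyad n <= s.
  by rewrite [leRHS]unit_dyad ler_wpM2r ?(ltW dn)// truncn_le mulr_ge0.
have q2 : s <= q.+1%:R * dyad n.
  by rewrite [leLHS]unit_dyad ler_wpM2r ?(ltW dn)// ltW// truncnS_gt.
have q3 : q.+2%:R * dyad n <= t.
  rewrite -addn2 natrD mulrDl; lra.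
exists q.+1; split => //.
rewrite -(ltr_nat R) -(ltr_pM2r dn) [ltRHS]dyad_natr (lt_le_trans _ t1)//.
by rewrite (lt_le_trans _ q3)// ltr_pM2r// ltr_nat.
Qed.

(** For [U] of diameter [d] about [2^-n], the image of [U] within [E] is covered by about
    [2^(n eps)] sets of diameter about [2^(-n (1 / b - eps))]. Their weights at exponent [b s'] sum
    to about [2^(-n s)], comparable to [d^s]. *)
Lemma hausdorff_measure_image f E (b s s' : R) : 0 < b -> E `<=` `[0, 1] ->
  (forall eps, 0 < eps -> exists n0 D, 0 < D /\
    forall n k X, (n0 <= n)%N -> (k < 2 ^ n)%N ->
    X `<=` E -> (forall t, X t -> k%:R * dyad n <= t <= k.+2%:R * dyad n) ->
    exists V : nat -> set R,
      [/\ f @` X `<=` \bigcup_j V j,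
          forall j, (diam (V j) <= (D * dyad n `^ (b^-1 - eps))%:E)%E &
          exists L : nat, L%:R <= D * dyad n `^ (- eps) /\
            forall j, (L <= j)%N -> V j = set0]) ->
  0 <= s -> s < s' ->
  hausdorff_measure s E = 0%E -> hausdorff_measure (b * s') (f @` E) = 0%E.
Proof.
move=> b0 E01 cover s0 ss'; have s'0 := le_lt_trans s0 ss'.
have bs0 : 0 < b * s' by exact: mulr_gt0.
(* The solution of [- eps + (1 / b - eps) (b s') = s]. *)
pose eps := (s' - s) / (1 + b * s').
have bs1 : 0 < 1 + b * s' by rewrite addr_gt0.
have e0 : 0 < eps by rewrite divr_gt0// subr_gt0.
have p0 : 0 < b^-1 - eps.
  rewrite subr_gt0 /eps ltr_pdivrMr// mulrDr mulr1 mulrA mulVf ?gt_eqF// mul1r.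
  by have : 0 < b^-1; [rewrite invr_gt0|lra].
have [n0 [D [D0 HD]]] := cover _ e0.
apply: (@hausdorff_measure_transfer _ _ _ _ _ (fun U => f @` (E `&` U))).
  move=> C EC _ [t Et <-]; have [n _ Cnt] := EC _ Et.
  by exists n => //; exists t.
move=> delta delta0.
have [n1 Hn1] := exists_dyad_powR_le p0 (divr_gt0 delta0 D0).
exists (dyad (maxn n0 n1)), (D * D `^ (b * s') * 2 `^ s); split.
- exact: dyad_gt0.
- by rewrite !mulr_gt0 ?powR_gt0.
move=> U dU; have [XU|/set0P[x0 Xx0]] := eqVneq (E `&` U) set0.
  exists (fun=> set0); split => [|j|]; rewrite ?XU ?image_set0//.
    by rewrite diam0 leNye.
  rewrite eseries0; last by move=> *; exact: diam_pow0.
  by rewrite mule_ge0 ?diam_pow_ge0// lee_fin !mulr_ge0 ?powR_ge0// ltW.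
have U0 : U !=set0 by exists x0; case: Xx0.
have [d [dUE d0 dn]] := diam_fin U0 dU.
have Xd x y : (E `&` U) x -> (E `&` U) y -> `|x - y| <= d.
  by move=> [_ Ux] [_ Uy]; rewrite -lee_fin -dUE; exact: le_diam.
rewrite (diam_powE _ U0 dUE) -EFinM.
(* Diameter 0 has no dyadic scale; the image is then one point, of weight 0 since [b s' > 0]. *)
have [d_eq0|d_neq0] := eqVneq d 0.
  have single : (f @` (E `&` U)) = [set f x0].
    apply/seteqP; split => [_ [t Xt <-]|_ ->]; last by exists x0.
    have := Xd _ _ Xt Xx0; rewrite d_eq0 normr_le0 subr_eq0 => /eqP -> //.
  have d1 : (diam [set f x0] <= 0%:E)%E.
    by apply: diam_le => _ _ -> ->; rewrite subrr normr0.
  exists (fun j => if j is 0%N then [set f x0] else set0); split.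
  - by rewrite single => _ ->; exists 0%N.
  - move=> [|j]; last by rewrite diam0 leNye.
    by rewrite (le_trans d1)// lee_fin ltW.
  apply: (@le_trans _ _ (1%:R * 0)%:E).
    apply: eseries_bounded_support => -[|j]//=; rewrite ?diam_pow_ge0/= ?diam_pow0//.
    by rewrite (le_trans (diam_pow_le (ltW bs0) d1))// powR0 ?gt_eqF.
  by rewrite mulr0 lee_fin !mulr_ge0 ?powR_ge0// ltW.
have d_gt0 : 0 < d by rewrite lt0r d_neq0.
have [i /andP[id di]] := dyad_bracket d_gt0 dn.
set n := (maxn n0 n1 + i)%N in id di.
have X01 : E `&` U `<=` `[0, 1] by move=> t [/E01].
have [k [kn Hk]] : exists k, (k < 2 ^ n)%N /\
    forall t, (E `&` U) t -> k%:R * dyad n <= t <= k.+2%:R * dyad n.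
  apply: dyadic_window => //; first by exists x0.
  by move=> x y Xx Xy; rewrite (le_trans _ di)// Xd.
have nn0 : (n0 <= n)%N by exact: leq_trans (leq_maxl _ _) (leq_addr _ _).
have nn1 : (n1 <= n)%N by exact: leq_trans (leq_maxr _ _) (leq_addr _ _).
have [V [XV dV [L [LD VL]]]] := HD n k _ nn0 kn (@subIsetl _ E U) Hk.
exists V; split => // [j|].
  apply: (le_trans (dV j)); rewrite lee_fin -ler_pdivlMl// mulrC; exact: Hn1.
set r := D * dyad n `^ (b^-1 - eps) in dV.
apply: (@le_trans _ _ (L%:R * r `^ (b * s'))%:E).
  apply: eseries_bounded_support => j; last by move=> /VL ->; rewrite diam_pow0.
  by rewrite diam_pow_ge0 diam_pow_le// ltW.
rewrite lee_fin.
apply: (@le_trans _ _ (D * dyad n `^ (- eps) * r `^ (b * s'))).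
  by rewrite ler_wpM2r ?powR_ge0.
rewrite /r powRM ?powR_ge0 ?(ltW D0)// -powRrM mulrACA -dyad_powRD.
have -> : - eps + (b^-1 - eps) * (b * s') = s.
  by rewrite /eps; field; rewrite !gt_eqF.
rewrite -[leRHS]mulrA ler_wpM2l//; first by rewrite mulr_ge0 ?powR_ge0// ltW.
rewrite -powRM ?(ltW d_gt0)//; apply: ge0_ler_powR => //.
- by rewrite nnegrE ltW// dyad_gt0.
- by rewrite nnegrE mulr_ge0.
(* [dyad n <= 2 d] accounts for the factor [2^s] in the constant. *)
by have := dyadS (R := R) n; lra.
Qed.

(** The lower bound on increments makes the inverse of [f] Hoelder of exponent [g = b / (1 + eps)]
    at small scales. The preimage of a set of diameter [d] then has diameter at most [D d^g], and
    weight at exponent [s' / b] at most a constant times [d^s]. *)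
Lemma hausdorff_measure_preimage f E (b s s' : R) : 0 < b -> E `<=` `[0, 1] ->
  (exists n0, forall n k x y, (n0 <= n)%N -> (k < 2 ^ n)%N -> E x -> E y ->
     x <= k%:R * dyad n -> k.+1%:R * dyad n <= y ->
     gap n `^ b^-1 <= f y - f x) ->
  0 <= s -> s < s' ->
  hausdorff_measure s (f @` E) = 0%E -> hausdorff_measure (b^-1 * s') E = 0%E.
Proof.
move=> b0 E01 [n0 gap_le] s0 ss'; have s'0 := le_lt_trans s0 ss'.
have s10 : 0 < s + 1 by rewrite ltr_wpDl.
(* Ensures [s (1 + eps) <= s']; the denominator stays positive at [s = 0]. *)
pose eps := (s' - s) / (s + 1).
have e0 : 0 < eps by rewrite divr_gt0// subr_gt0.
have e10 : 0 < 1 + eps by rewrite addr_gt0.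
have [C [C0 HC]] := natS_le_dyad_powR e0.
pose g := b / (1 + eps); have g0 : 0 < g by rewrite divr_gt0.
(* [n + 1 <= C 2^(n eps)] gives [2^(-n (1 + eps)) <= 16 C gap n]; the 4 comes from
   [y - x <= 4 * dyad i.+1] in [holder]. *)
pose D := 4 * (16 * C) `^ (1 + eps)^-1.
have D0 : 0 < D by rewrite mulr_gt0// powR_gt0// mulr_gt0.
have dyad_le_incr n (D' : R) : 0 <= D' -> gap n `^ b^-1 <= D' ->
    4 * dyad n <= D * D' `^ g.
  move=> D'0 gD.
  have dn := dyad_gt0 (R := R) n.
  have gapD : gap n <= D' `^ b.
    rewrite -[leLHS]powRr1 ?(ltW (gap_gt0 _))// -(mulVf (lt0r_neq0 b0)) powRrM.
    by apply: ge0_ler_powR; rewrite ?nnegrE ?powR_ge0 ?(ltW b0).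
  have d1e : dyad n `^ (1 + eps) <= 16 * C * D' `^ b.
    apply: (@le_trans _ _ (16 * C * gap n)); last first.
      by rewrite ler_wpM2l// mulr_ge0// ltW.
    rewrite /gap mulrA ler_pdivlMr ?mulr_gt0// dyad_powRD powRr1 ?(ltW dn)//.
    rewrite mulrACA.
    rewrite (_ : 16 * C * dyad n = dyad n * 16 * C); last by ring.
    rewrite ler_wpM2l ?mulr_ge0 ?(ltW dn)//.
    rewrite mulrC -ler_pdivlMr ?dyad_powR_gt0// -powRN; exact: HC.
  rewrite /D -mulrA ler_wpM2l// /g.
  rewrite powRrM -powRM ?powR_ge0//; last by rewrite mulr_ge0// ltW.
  have dE : dyad n = (dyad n `^ (1 + eps)) `^ (1 + eps)^-1.
    by rewrite -powRrM divff ?gt_eqF// powRr1// ltW.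
  rewrite [leLHS]dE.
  apply: ge0_ler_powR; rewrite ?nnegrE ?powR_ge0 ?invr_ge0 ?(ltW e10)//.
  by rewrite !mulr_ge0 ?powR_ge0// ltW.
have holder (x y D' : R) : E x -> E y -> x <= y -> 0 <= D' -> f y - f x <= D' ->
    D' < gap n0 `^ b^-1 -> y - x <= D * D' `^ g.
  move=> Ex Ey xy D'0 fD Dgap.
  have := E01 _ Ex; have := E01 _ Ey; rewrite /= !in_itv/= => /andP[_ y1] /andP[x0 _].
  move: xy; rewrite le_eqVlt => /predU1P[->|xy].
    by rewrite subrr mulr_ge0 ?powR_ge0// ltW.
  (* Halving the distance leaves room for a dyadic interval of level [i.+1] between [x] and [y]. *)
  have x20 : 0 < (y - x) / 2 by rewrite divr_gt0// subr_gt0.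
  have x21 : (y - x) / 2 <= dyad 0 by rewrite /dyad expr0; lra.
  have [i] := dyad_bracket x20 x21.
  rewrite add0n => /andP[i1 i2]; have d2 := dyadS (R := R) i.
  apply: (@le_trans _ _ (4 * dyad i.+1)); first by lra.
  have [ni|ni] := leqP n0 i.+1.
    apply: dyad_le_incr => //; apply: le_trans fD.
    have [|k [k2 xk ky]] := @dyadic_inside x y i.+1 x0 y1; first by lra.
    exact: gap_le k2 Ex Ey xk ky.
  (* Points this far apart have a dyadic interval of level [n0] between them, which forces an
     increment contradicting [Dgap]. *)
  have dd : dyad n0 <= dyad i.+1 :> R by apply: dyad_le; exact: ltnW.
  have [|k [k2 xk ky]] := @dyadic_inside x y n0 x0 y1; first by lra.
  have := gap_le _ _ _ _ (leqnn n0) k2 Ex Ey xk ky.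
  by move=> /le_trans/(_ fD)/(lt_le_trans Dgap); rewrite ltxx.
apply: (@hausdorff_measure_transfer _ _ _ _ _ (fun U => [set t | E t /\ U (f t)])).
  move=> C' EC t Et; have [|n _ Cnt] := EC (f t); first by exists t.
  by exists n.
move=> delta delta0.
(* The 1 serves the final comparison of powers of [d], the halved gap the strict inequality in
   [holder], the last term the bound [delta] on diameters. *)
pose d0 := Num.min (Num.min 1 (gap n0 `^ b^-1 / 2)) ((delta / D) `^ g^-1).
have dd0 : 0 < delta / D by rewrite divr_gt0.
exists d0, (D `^ (b^-1 * s')); split.
- by rewrite !lt_min ltr01 divr_gt0 ?powR_gt0// gap_gt0.
- exact: powR_gt0.
move=> U dU; set X := [set t | _].
have [X0|/set0P[x0 Xx0]] := eqVneq X set0.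
  exists (fun=> set0); split => [|j|]; rewrite ?X0//.
    by rewrite diam0 leNye.
  rewrite eseries0; last by move=> *; exact: diam_pow0.
  by rewrite mule_ge0 ?diam_pow_ge0// lee_fin powR_ge0.
have U0 : U !=set0 by exists (f x0); case: Xx0.
have [d [dUE dge0 dd]] := diam_fin U0 dU.
have [d1 dgap ddelta] : [/\ d <= 1, d < gap n0 `^ b^-1 & d <= (delta / D) `^ g^-1].
  move: dd; rewrite !le_min => /andP[/andP[-> dg] ->]; split => //.
  have := powR_gt0 b^-1 (gap_gt0 (R := R) n0); move: dg; set z := _ `^ _.
  by lra.
have diamX : (diam X <= (D * d `^ g)%:E)%E.
  have inc x y : X x -> X y -> x <= y -> `|x - y| <= D * d `^ g.
    move=> [Ex Ux] [Ey Uy] xy; rewrite distrC ger0_norm ?subr_ge0//.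
    apply: holder => //; rewrite -lee_fin -dUE.
    by apply: le_trans (le_diam Uy Ux); rewrite lee_fin ler_norm.
  apply: diam_le => x y Xx Xy; have [xy|/ltW yx] := leP x y; first exact: inc.
  by rewrite distrC inc.
exists (fun j => if j is 0%N then X else set0); split.
- by move=> t Xt; exists 0%N.
- move=> [|j]; last by rewrite diam0 leNye.
  rewrite (le_trans diamX)// lee_fin -ler_pdivlMl// mulrC.
  have -> : delta / D = ((delta / D) `^ g^-1) `^ g.
    by rewrite -powRrM mulVf ?gt_eqF// powRr1// ltW.
  by apply: ge0_ler_powR; rewrite ?nnegrE ?powR_ge0 ?(ltW g0).
have bs0 : 0 < b^-1 * s' by rewrite mulr_gt0// invr_gt0.
rewrite (diam_powE _ U0 dUE) -EFinM.
apply: (@le_trans _ _ (1%:R * (D `^ (b^-1 * s') * d `^ s))%:E); last by rewrite mul1r.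
apply: eseries_bounded_support => -[|j]//=; rewrite ?diam_pow_ge0/= ?diam_pow0//; last first.
  by rewrite lee_fin mulr_ge0 ?powR_ge0.
apply: (le_trans (diam_pow_le (ltW bs0) diamX)); rewrite lee_fin.
rewrite powRM ?powR_ge0 ?(ltW D0)// ler_wpM2l ?powR_ge0// -powRrM.
have -> : g * (b^-1 * s') = s' / (1 + eps).
  by rewrite /g; field; rewrite !gt_eqF.
have se0 : 0 < s' / (1 + eps) by rewrite divr_gt0.
move: dge0; rewrite le_eqVlt => /predU1P[<-|d_gt0].
  by rewrite powR0 ?powR_ge0// gt_eqF.
apply: ger_powR; first by rewrite d_gt0.
rewrite ler_pdivlMr// /eps mulrDr mulr1 -lerBrDl mulrA ler_pdivrMr//.
by rewrite mulrC ler_wpM2l ?subr_ge0 ?(ltW ss')//; lra.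
Qed.

End dimension_distortion.

(** * Dimension of the image of a set under the path *)

Section jump_path_dimension.
Context {R : realType}.
Variables (eps0 : R) (beta : R -> R) (mu : {measure set (R * R) -> \bar R})
  (f : R -> R).
Hypothesis eps0_gt0 : 0 < eps0.
Hypothesis beta_range : forall x : R, eps0 <= beta x <= 1 - eps0.
Hypothesis beta_mono : {homo beta : x y / x <= y}.
Hypothesis f_cadlag : cadlag01 f.
Hypothesis f_sde : forall t : R, 0 <= t <= 1 ->
  (f t)%:E =
  (\int[mu]_(p in box 0 t 0 1) (p.2 `^ (beta (left_limit f p.1))^-1)%:E)%E.
Hypothesis mu_typical : typical mu.
Implicit Type E : set R.

Lemma path_dim_ge E (b : R) : E `<=` `[0, 1] -> 0 < b ->
  (forall t, E t -> b <= beta (f t)) ->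
  (hausdorff_dim E * b%:E <= hausdorff_dim (f @` E))%E.
Proof.
move=> E01 b0 Eb; rewrite -lee_pdivlMr//.
apply: hausdorff_dim_scale; first by rewrite invr_gt0.
move=> s s' s0 ss'; apply: hausdorff_measure_preimage ss' => //.
have [n0 Hn0] := typical_lower mu_typical.
exists n0 => n k x y nn0 kn Ex Ey xk ky.
have := E01 _ Ex; have := E01 _ Ey; rewrite /= !in_itv/= => /andP[_ y1] /andP[x0 _].
apply: (increment_ge eps0_gt0 beta_range beta_mono f_cadlag f_sde) xk ky y1 b0 _ => //.
  exact: Hn0.
exact: Eb.
Qed.

Lemma path_dim_le E (b : R) : E `<=` `[0, 1] -> 0 < b -> b < 1 ->
  (forall t, E t -> beta (left_limit f t) <= b) ->
  (hausdorff_dim (f @` E) <= hausdorff_dim E * b%:E)%E.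
Proof.
move=> E01 b0 b1 Eb; apply: hausdorff_dim_scale => // s s' s0 ss'.
apply: hausdorff_measure_image ss' => // eps e0.
exact: (path_cover eps0_gt0 beta_range beta_mono f_cadlag f_sde).
Qed.

Lemma hausdorff_dim_set0 : hausdorff_dim (@set0 R) = 0%E.
Proof.
apply/eqP; rewrite eq_le hausdorff_dim_ge0 andbT.
apply: hausdorff_dim_le => //; apply/hausdorff_measure0P => delta e d0 e0.
exists (fun=> set0); first by split => // n; rewrite diam0 leNye.
rewrite eseries0; last by move=> *; exact: diam_pow0.
by rewrite lee_fin ltW.
Qed.

Lemma path_dim_bounds E : E `<=` `[0, 1] ->
  (hausdorff_dim E * ereal_inf [set (beta (f t))%:E | t in E]
     <= hausdorff_dim (f @` E)
     <= hausdorff_dim E *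
        ereal_sup [set (beta (left_limit f t))%:E | t in E])%E.
Proof.
(* For empty [E] the extrema are infinite, but the products vanish since the dimension is 0.
   Otherwise they are finite, and the supremum is at most [1 - eps0 < 1]. *)
move=> E01; have [->|/set0P[t0 Et0]] := eqVneq E set0.
  by rewrite !image_set0 hausdorff_dim_set0 !mul0e lexx.
set m := ereal_inf _; set M := ereal_sup _.
have m_le t : E t -> (m <= (beta (f t))%:E)%E.
  by move=> Et; apply: ereal_inf_lbound; exists t.
have le_M t : E t -> ((beta (left_limit f t))%:E <= M)%E.
  by move=> Et; apply: ereal_sup_ubound; exists t.
have m_ge : (eps0%:E <= m)%E.
  apply: le_ereal_inf_tmp => _ [t _ <-]; rewrite lee_fin.
  by have /andP[] := beta_range (f t).
have M_le : (M <= (1 - eps0)%:E)%E.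
  apply: ge_ereal_sup => _ [t _ <-]; rewrite lee_fin.
  by have /andP[] := beta_range (left_limit f t).
have mfin : m \is a fin_num.
  by rewrite fin_numElt (lt_le_trans _ m_ge) ?ltNyr// (le_lt_trans (m_le _ Et0)) ?ltry.
have Mfin : M \is a fin_num.
  by rewrite fin_numElt (lt_le_trans _ (le_M _ Et0)) ?ltNyr// (le_lt_trans M_le) ?ltry.
move: m_ge m_le M_le le_M.
rewrite -(fineK mfin) -(fineK Mfin); set b := fine m; set c := fine M.
rewrite !lee_fin => m_ge m_le M_le le_M; apply/andP; split.
  by apply: path_dim_ge => //; exact: lt_le_trans m_ge.
apply: path_dim_le => //.
  have := le_M _ Et0; rewrite lee_fin; apply: lt_le_trans.
  exact: beta_gt0 eps0_gt0 beta_range _.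
by rewrite (le_lt_trans M_le)// gtrBl.
Qed.

(** If [y < x S] with [x] and [y] finite and [x > 0], the midpoint of [y / x] and [S] is a value of
    [c] violating the assumption. *)
Lemma mule_le_of_lt (x y : \bar R) (S : R) : (0 <= x)%E -> (0 <= y)%E -> 0 < S ->
  (forall c, 0 < c -> c < S -> (x * c%:E <= y)%E) -> (x * S%:E <= y)%E.
Proof.
move=> x0 y0 S0 H; case: y y0 H => [y| |] y0 H; [|by rewrite leey|by []].
case: x x0 H => [x| |] x0 H; [|exfalso|by []]; last first.
  have S20 : 0 < S / 2 by rewrite divr_gt0.
  have S2 : S / 2 < S by lra.
  by have := H _ S20 S2; rewrite gt0_mulye ?lte_fin// leye_eq.
rewrite !lee_fin in x0 y0.
rewrite -EFinM lee_fin leNgt; apply/negP => yx.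
move: x0; rewrite le_eqVlt => /predU1P[x0|x0].
  by move: yx; rewrite -x0 mul0r ltNge y0.
have c0 : 0 < (y / x + S) / 2.
  by rewrite divr_gt0// ltr_wpDl// divr_ge0// ltW.
have yS : y / x < S by rewrite ltr_pdivrMr// mulrC.
have cS : (y / x + S) / 2 < S by lra.
have := H _ c0 cS; rewrite -EFinM lee_fin.
have -> : x * ((y / x + S) / 2) = (y + x * S) / 2.
  by field; rewrite gt_eqF.
lra.
Qed.

Lemma exists_before_left_limit (k t0 c : R) : 0 <= k ->
  (forall x y : R, `|beta x - beta y| <= k * `|x - y|) ->
  0 < t0 -> t0 <= 1 -> c < beta (left_limit f t0) ->
  exists x, [/\ 0 < x, x < t0 & c < beta (f x)].
Proof.
move=> k0 lip t00 t01; rewrite /left_limit gt_eqF// => cl.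
have cf : cvg (f x @[x --> t0^'-]) by apply: f_cadlag.2; rewrite t00.
set l := lim _ in cl *.
(* Continuity of [beta] from its Lipschitz bound; [k + 1] allows [k = 0]. *)
pose e := (beta l - c) / (k + 1).
have e0 : 0 < e by rewrite divr_gt0 ?subr_gt0// ltr_wpDl.
near (t0^'-) => x; exists x; split.
- by near: x; exact: nbhs_left_gt.
- by near: x; exact: nbhs_left_lt.
have lx : `|l - f x| < e by near: x; move/cvgrPdist_lt : cf => /(_ _ e0).
have key : k * `|l - f x| < beta l - c.
  apply: (@le_lt_trans _ _ (k * e)); first by rewrite ler_wpM2l// ltW.
  rewrite /e mulrA ltr_pdivrMr ?ltr_wpDl// mulrC ltr_pM2l ?subr_gt0//.
  by rewrite ltrDl.
by have := le_lt_trans (ler_norm _) (le_lt_trans (lip l (f x)) key); lra.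
Unshelve. all: by end_near. Qed.

(** Any positive [c] below the supremum is a lower bound of [beta] along the path on some interval,
    in which [E] keeps its full dimension. *)
Lemma path_dim_homogeneous E (k : R) : 0 <= k ->
  (forall x y : R, `|beta x - beta y| <= k * `|x - y|) -> E `<=` `[0, 1] ->
  (forall I : set R, is_interval I -> I `<=` `[0, 1] ->
     (exists x y : R, [/\ I x, I y & x < y]) ->
     hausdorff_dim E = hausdorff_dim (E `&` I)) ->
  hausdorff_dim (f @` E) =
  (hausdorff_dim E * ereal_sup [set (beta (left_limit f t))%:E | t in E])%E.
Proof.
move=> k0 lip E01 Ehom; apply/eqP; rewrite eq_le.
have /andP[_ ->] := path_dim_bounds E01; rewrite /=.
have [->|/set0P[t1 Et1]] := eqVneq E set0.
  by rewrite !image_set0 hausdorff_dim_set0 !mul0e.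
set M := ereal_sup _.
have M_ge : ((beta (left_limit f t1))%:E <= M)%E.
  by apply: ereal_sup_ubound; exists t1.
have M_le : (M <= (1 - eps0)%:E)%E.
  apply: ge_ereal_sup => _ [t _ <-]; rewrite lee_fin.
  by have /andP[] := beta_range (left_limit f t).
have Mfin : M \is a fin_num.
  by rewrite fin_numElt (lt_le_trans _ M_ge) ?ltNyr// (le_lt_trans M_le) ?ltry.
have bpos := beta_gt0 eps0_gt0 beta_range.
have M0 : 0 < fine M.
  by rewrite (lt_le_trans (bpos (left_limit f t1)))// -lee_fin fineK.
have fmono := path_mono f_sde.
rewrite -(fineK Mfin); apply: mule_le_of_lt; rewrite ?hausdorff_dim_ge0// => c c0.
rewrite -lte_fin fineK// => /ereal_sup_gt[_ [t Et <-]]; rewrite lte_fin => ct.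
have := E01 _ Et; rewrite /= in_itv/= => /andP[t_ge0 t_le1].
move: t_ge0; rewrite le_eqVlt => /predU1P[t0|t_gt0].
  (* At [t = 0] the left limit is [f 0], the minimum of the path, so [c] is a lower bound on all of
     [E]. *)
  apply: path_dim_ge => // u /E01; rewrite /= in_itv/= => /andP[u0 u1].
  rewrite (le_trans (ltW ct))// beta_mono// -t0 /left_limit eqxx.
  exact: fmono.
have [x [x0 xt cx]] := exists_before_left_limit k0 lip t_gt0 t_le1 ct.
have I01 : `[x, t[ `<=` `[0, 1].
  move=> u; rewrite /= !in_itv/= => /andP[xu ut].
  by rewrite (le_trans (ltW x0) xu) (le_trans (ltW ut)).
rewrite (Ehom `[x, t[%classic)//; last 2 first.
- exact: interval_is_interval.
- exists x, ((x + t) / 2); rewrite /= !in_itv/=; split; [|apply/andP; split|]; lra.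
have sub : f @` (E `&` `[x, t[) `<=` f @` E.
  by move=> _ [u [Eu _] <-]; exists u.
apply: le_trans (hausdorff_dim_subset sub).
apply: path_dim_ge => // [u [/E01]//|u [/E01]].
rewrite /= !in_itv/= => /andP[u0 u1] /andP[xu ut].
rewrite (le_trans (ltW cx))// beta_mono//.
exact: fmono (ltW x0) xu u1.
Qed.

End jump_path_dimension.
Unset Implicit Arguments.

Theorem theorem6 (R : realType) (eps0 : R) (beta : R -> R)
    (heps0 : 0 < eps0)
    (hbeta_range : forall x : R, eps0 <= beta x <= 1 - eps0)
    (hbeta_nc : nowhere_constant beta)
    (hbeta_mono : {homo beta : x y / x <= y})
    (hbeta_lip : lipschitz beta)
    (d : measure_display) (T : measurableType d) (P : probability T R)
    (N : R.-ker T ~> (R * R)%type)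
    (hN : poisson_random_measure P (@jump_intensity R) N)
    (M : R -> T -> R)
    (hM : stable_like_process P N beta M) :
  {ae P, forall w, forall E : set R,
    completed_algebra_gen (@lebesgue_measure R) E ->
    E `<=` `[0, 1] ->
    let ME := [set M t w | t in E] in
    let inf_beta := ereal_inf [set (beta (M t w))%:E | t in E] in
    let sup_beta :=
      ereal_sup [set (beta (left_limit (M^~ w) t))%:E | t in E] in
    (hausdorff_dim E * inf_beta <= hausdorff_dim ME
       <= hausdorff_dim E * sup_beta)%E /\
    ((forall I : set R, is_interval I -> I `<=` `[0, 1] ->
        (exists x y : R, [/\ I x, I y & x < y]) ->
        hausdorff_dim E = hausdorff_dim (E `&` I)) ->
     hausdorff_dim ME = (hausdorff_dim E * sup_beta)%E)}.
Proof.
have [k [k_real lipk]] := hbeta_lip.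
(* [lipschitz] holds for every constant above a threshold [k] of unknown sign; this one is also
   nonnegative. *)
have k'0 : 0 <= Num.max k 0 + 1 by rewrite addr_ge0// le_max lexx orbT.
have lip x y : `|beta x - beta y| <= (Num.max k 0 + 1) * `|x - y|.
  apply: (lipk (Num.max k 0 + 1) _ (x, y)) => //.
  by rewrite (@le_lt_trans _ _ (Num.max k 0))// ?le_max ?lexx// ltrDl.
(* These three almost sure events do not involve [E], so one null set serves all sets at once. *)
apply: filterS3 (typical_ae hN) (slp_cadlag hM) (slp_sde hM).
move=> w typ cad sde E _ E01 /=; split.
  exact: (path_dim_bounds heps0 hbeta_range hbeta_mono cad sde typ E01).
exact: (path_dim_homogeneous heps0 hbeta_range hbeta_mono cad sde typ k'0 lip).
Qed.
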